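(* Let $\alpha=M\nu^{-2}\|f\|_{-1}$. Let $u\in V$ be a steady Navier-Stokes solution, $\epsilon\in V$ the noise function, with $I_H\epsilon\neq0$, $u_0\in V$, and let $(u_k)_{k\ge0}\subset V$ be the CDA-Picard iterates with noisy data, defined by $$\nu(\nabla u_{k+1},\nabla v)+b(u_k,u_{k+1},v)+\mu\big(I_Hu_{k+1}-I_H(u+\epsilon),\,I_Hv\big)=(f,v)\qquad\forall v\in V .$$ Denote the error by $e_k:=u_k-u$. Let $0<r<1$ and pick parameters $\mu$ and $H$ such that $$\frac{4\nu\alpha^4}{r^2}\le\mu\le\frac{\nu}{C_I^2H^2}\quad\text{and}\quad H\le\frac{r}{2C_I\alpha^2}.$$ Then for $k$ sufficiently large, the error in step $k$ of the iteration satisfies $$\|e_k\|\le\sqrt{\frac{4}{1-r}}\;\|I_H\epsilon\| .$$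
   Context: $\Omega\subset\mathbb{R}^d$, $d\in\{2,3\}$, is an open connected set that is a convex polygon or has smooth boundary. $(\cdot,\cdot)$ and $\|\cdot\|$ denote the $L^2(\Omega)$ inner product and norm. $X=\{v\in H^1(\Omega)^d: v=0\text{ on }\partial\Omega\}$, $Q=\{q\in L^2(\Omega):\int_\Omega q\,dx=0\}$, $V=\{v\in X:(\nabla\cdot v,q)=0\ \forall q\in Q\}$ (the divergence-free subspace). $\nu>0$ is the viscosity, $f\in H^{-1}(\Omega)^d$ is the forcing, $(f,v)=\langle f,v\rangle$ is the duality pairing, and $\|\cdot\|_{-1}$ is the $H^{-1}$ norm (dual to $\|\nabla\cdot\|$). $b(u,w,v)=((u\cdot\nabla)w,v)$. $M$ is a constant depending only on $\Omega$ such that $b(u,w,v)\le M\|u\|^{1/2}\|\nabla u\|^{1/2}\|\nabla w\|\|\nabla v\|$ and $b(u,w,v)\le M\|\nabla u\|\|\nabla w\|\|\nabla v\|$ for $u,w,v\in X$. A steady Navier-Stokes solution is a $u\in V$ with $\nu(\nabla u,\nabla v)+b(u,u,v)=\langle f,v\rangle$ for all $v\in V$ (here the one from which the measurement data were obtained); the paper assumes throughout that $\|\nabla u\|_{L^\infty}<\infty$. Data assimilation: $H>0$ is the width of a coarse mesh of $\Omega$, and $I_H$ is a (linear) coarse mesh interpolation operator for which there is a constant $C_I>0$ independent of $H$ with $\|I_Hv-v\|\le C_IH\|\nabla v\|$ and $\|I_Hv\|\le C_I\|v\|$ for all $v\in X$. $\mu>0$ is the nudging parameter. The known data are $u(x_i)+\epsilon_i$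 at measurement points $x_i$; $\epsilon\in V$ is any divergence-free function with $I_H\epsilon(x_i)=\epsilon_i$, and $\delta\ge0$ denotes a relative noise size constant with $\|\nabla(u+\epsilon)\|\le(1+\delta)\|\nabla u\|$. *)

(* Defs.v *)
From HB Require Import structures.
From mathcomp Require Import all_boot all_order all_algebra.
From mathcomp Require Import all_classical all_reals all_analysis.

Set Implicit Arguments.
Unset Strict Implicit.
Unset Printing Implicit Defensive.
Import Order.TTheory GRing.Theory Num.Theory.
Import numFieldNormedType.Exports.

Local Open Scope classical_set_scope.
Local Open Scope ring_scope.

(* The sigma-algebra on row vectors is generated by the coordinates (it is the
   Borel one), as the library does for [n.-tuple T]. *)
Section measurable_rV.
Context (R : realType) (n : nat).

Let coord (i : 'I_n) (x : 'rV[R]_n) : R := x ord0 i.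

Let rV_set0 : g_sigma_preimage coord set0.
Proof. exact: sigma_algebra0. Qed.

Let rV_setC A : g_sigma_preimage coord A -> g_sigma_preimage coord (~` A).
Proof. exact: sigma_algebraC. Qed.

Let rV_bigcup (F : _^nat) : (forall i, g_sigma_preimage coord (F i)) ->
  g_sigma_preimage coord (\bigcup_i F i).
Proof. exact: sigma_algebra_bigcup. Qed.

HB.instance Definition _ := @isMeasurable.Build
  (measure_tuple_display default_measure_display) 'rV[R]_n
  (g_sigma_preimage coord) rV_set0 rV_setC rV_bigcup.

End measurable_rV.

Definition rV_cons (R : realType) n (p : 'rV[R]_n * measurableTypeR R) :
  'rV[R]_n.+1 := row_mx (const_mx p.2 : 'rV_1) p.1.

Lemma measurable_coord (R : realType) n (i : 'I_n) :
  measurable_fun setT (fun x : 'rV[R]_n => x ord0 i).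
Proof.
move=> _ Y mY; rewrite setTI; apply: sub_sigma_algebra => /=.
rewrite -bigcup_seq/=; exists i => /=; first by rewrite mem_index_enum.
by exists Y => //; rewrite setTI.
Qed.

Lemma measurable_rV_cons (R : realType) n :
  measurable_fun setT (@rV_cons R n).
Proof.
move=> _; apply: (@measurability _ _ _ _ _ _
  (\big[setU/set0]_(i < n.+1) preimage_set_system setT
     (fun x : 'rV[R]_n.+1 => x ord0 i) measurable)) => //.
move=> _ [B + <-]; rewrite -bigcup_seq/= => -[i _ [A mA <-]].
rewrite !setTI -comp_preimage -[X in measurable X]setTI.
have [j|j] := split_ordP (i : 'I_(1 + n)) => ->.
- rewrite (_ : _ \o _ = fun p => p.2 : R).
    exact: (@measurable_snd _ _ 'rV[R]_n (measurableTypeR R)).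
  by apply/funext => p; rewrite /=; apply: etrans (row_mxEl _ _ _ _) _;
    rewrite mxE.
- rewrite (_ : _ \o _ = (fun x : 'rV[R]_n => x ord0 j) \o fst).
    by apply: measurableT_comp => //; exact: measurable_coord.
  by apply/funext => p; exact: row_mxEr.
Qed.

(* Lebesgue measure on R^n, by iterated products with Lebesgue measure on R. *)
Fixpoint lebesgue_rV (R : realType) n : {measure set 'rV[R]_n -> \bar R} :=
  match n with
  | 0 => dirac (0 : 'rV[R]_0)
  | n'.+1 => measure_function_pushforward__canonical__measure_function_Measure
      (lebesgue_rV R n' \x @lebesgue_measure R)%E (@measurable_rV_cons R n')
  end.

Section domain.
Context (R : realType) (d : nat).
Notation E := 'rV[R]_d.
Implicit Types (Omega : set E).

(* The partial derivative along the j-th coordinate. *)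
Definition pderive (j : 'I_d) (f : E -> R) : E -> R :=
  'D_(delta_mx ord0 j) f.

Fixpoint Ck (k : nat) (f : E -> R) : Prop :=
  match k with
  | 0 => continuous f
  | k'.+1 => (forall x, differentiable f x) /\ forall j, Ck k' (pderive j f)
  end.

Definition smooth (f : E -> R) := forall k, Ck k f.

Definition test_function Omega (phi : E -> R) :=
  smooth phi /\
  exists K, [/\ compact K, K `<=` Omega & forall x, ~ K x -> phi x = 0].

Definition convex_polytope Omega :=
  bounded_set Omega /\
  exists (m : nat) (a : 'I_m -> E) (c : 'I_m -> R),
    Omega = [set x | forall k, \sum_i a k ord0 i * x ord0 i < c k].

(* Near each boundary point, Omega is a strict sublevel set of a smooth function
   whose gradient does not vanish at that point. *)
Definition smooth_boundary Omega :=
  forall x, (closure Omega `\` Omega°) x ->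
  exists rho : E -> R, [/\ smooth rho, exists j, pderive j rho x != 0 &
    \forall y \near x, Omega y <-> rho y < 0].

End domain.

Section function_spaces.
Context (R : realType) (d : nat) (Omega : set 'rV[R]_d).
Notation E := 'rV[R]_d.
Notation leb := (lebesgue_rV R d).

(* A function on Omega is represented by a function on the whole space, whose
   values outside Omega are irrelevant. *)
Definition in_Lp (p : \bar R) m n (A : E -> 'M[R]_(m, n)) :=
  forall i j, (fun x => A x i j) \_ Omega \in Lfun leb p.

Definition inner m n (A B : E -> 'M[R]_(m, n)) : R :=
  \int[leb]_(x in Omega) \sum_i \sum_j A x i j * B x i j.

Definition normL2 m n (A : E -> 'M[R]_(m, n)) : R := Num.sqrt (inner A A).

(* A Sobolev vector field is a pair [v], where [v.1] is the field itself and
   [v.2] is its weak Jacobian, [v.2 x i j] standing for the j-th weak partial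
   derivative of the i-th component.  Since [v.1] determines [v.2] almost
   everywhere on Omega, this is the usual H^1(Omega)^d. *)
Notation field := ((E -> E) * (E -> 'M[R]_d))%type.
Implicit Types u v w : field.

Definition H1 : set field := [set v |
  [/\ in_Lp 2%:E v.1, in_Lp 2%:E v.2 &
    forall i j phi, test_function Omega phi ->
      \int[leb]_(x in Omega) (v.1 x ord0 i * pderive j phi x) =
      - \int[leb]_(x in Omega) (v.2 x i j * phi x)]].

Definition jacobian_of (phi : E -> E) : E -> 'M[R]_d :=
  fun x => \matrix_(i, j) pderive j (fun y => phi y ord0 i) x.

(* Vanishing on the boundary is meant in the sense of traces: X is the closure
   in H^1 of the smooth fields with compact support in Omega. *)
Definition X : set field := [set v | H1 v /\
  forall e : R, 0 < e -> exists phi : E -> E,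
    [/\ forall i, test_function Omega (fun x => phi x ord0 i),
        normL2 (v.1 - phi) < e & normL2 (v.2 - jacobian_of phi) < e]].

(* On a bounded Omega, square-integrable functions are integrable. *)
Definition Q : set (E -> R) := [set q | q \_ Omega \in Lfun leb 2%:E /\
  leb.-integrable Omega (EFin \o q) /\ \int[leb]_(x in Omega) q x = 0].

Definition V : set field := [set v | X v /\
  forall q, Q q -> \int[leb]_(x in Omega) (\tr (v.2 x) * q x) = 0].

(* The integrand (u . grad) w . v of the convection form. *)
Definition convection u w v (x : E) : R :=
  \sum_i \sum_j u.1 x ord0 j * w.2 x i j * v.1 x ord0 i.

Definition b u w v : R := \int[leb]_(x in Omega) convection u w v x.

(* The integrability clause says that [b u w v] is a well-defined integral (it
   is in dimensions 2 and 3); [Rintegral] is otherwise a default value. *)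
Definition convection_constant (M : R) := forall u w v, X u -> X w -> X v ->
  [/\ leb.-integrable Omega (EFin \o convection u w v),
      b u w v <= M * Num.sqrt (normL2 u.1) * Num.sqrt (normL2 u.2) *
                 normL2 w.2 * normL2 v.2 &
      b u w v <= M * normL2 u.2 * normL2 w.2 * normL2 v.2].

(* f in H^{-1}(Omega)^d and its duality pairing with X; boundedness makes [f v.1]
   depend only on the class of v modulo almost everywhere equality. *)
Definition Hm1 : set ((E -> E) -> R) := [set f |
  (forall (a : R) v w, X v -> X w ->
     f (a *: v.1 + w.1) = a * f v.1 + f w.1) /\
  exists C : R, forall v, X v -> `|f v.1| <= C * normL2 v.2].

Definition normHm1 (f : (E -> E) -> R) : R :=
  sup [set `|f v.1| | v in [set v | X v /\ normL2 v.2 <= 1]].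

Definition coarse_interpolation (H C_I : R) (I_H : (E -> E) -> (E -> E)) :=
  [/\ forall v, X v -> in_Lp 2%:E (I_H v.1),
      forall (a : R) v w, X v -> X w -> {ae leb, forall x, Omega x ->
        I_H (a *: v.1 + w.1) x = a *: I_H v.1 x + I_H w.1 x},
      forall v, X v -> normL2 (I_H v.1 - v.1) <= C_I * H * normL2 v.2 &
      forall v, X v -> normL2 (I_H v.1) <= C_I * normL2 v.1].

Definition steady_NSE (nu : R) (f : (E -> E) -> R) u := V u /\
  forall v, V v -> nu * inner u.2 v.2 + b u u v = f v.1.

Definition CDA_Picard_step (nu mu : R) (f : (E -> E) -> R)
    (I_H : (E -> E) -> (E -> E)) (data u u' : field) :=
  forall v, V v ->
    nu * inner u'.2 v.2 + b u u' v
    + mu * inner (I_H u'.1 - I_H data.1) (I_H v.1) = f v.1.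

End function_spaces.

Notation sobolev_field R d :=
  (('rV[R]_d -> 'rV[R]_d) * ('rV[R]_d -> 'M[R]_d))%type.

(* Main.v *)
From HB Require Import structures.
Require Import Defs.
From mathcomp Require Import all_boot all_order all_algebra.
From mathcomp Require Import all_classical all_reals all_analysis.
From mathcomp Require Import measurable_realfun ring lra.

Set Implicit Arguments.
Unset Strict Implicit.
Unset Printing Implicit Defensive.
Import Order.TTheory GRing.Theory Num.Theory.
Import numFieldNormedType.Exports.

Local Open Scope classical_set_scope.
Local Open Scope ring_scope.

(** Write [e = v' - u] for the error after one step from [v], and [D] for the
    gradient.  Subtracting the steady equation from the iteration and testing
    with [e], which is solenoidal, gives the energy identity [error_energy]:
<<
      nu |De|^2 + mu |I_H e|^2 = b(u - v, u, e) + mu (I_H eps, I_H e).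
>>
    The convective term [b(v, e, e)] has disappeared from it because transport
    by a solenoidal field is skew-symmetric ([b_skew]).  Testing the steady
    equation with [u] itself bounds [M |Du|] by [nu alpha]
    ([steady_convection_bound]), so the first term on the right is at most
    [nu alpha |u - v|^(1/2) |D(u - v)|^(1/2) |De|].  Young's inequality absorbs
    [De] and [I_H e] on the left, and [mu C_I^2 H^2 <= nu] lets the interpolant
    [I_H e], together with the gradient, control [e] itself.  For
<<
      y_k = nu/2 |D e_k|^2 + mu/4 |e_k|^2
>>
    this yields [y_(k+1) <= (3/4) r y_k + mu |I_H eps|^2]
    ([error_contraction]); the lower bound on [mu] is what turns the quadratic
    term [nu alpha^2 |e_k| |D e_k|] into [(3/4) r y_k].  The limiting bound
    [mu |I_H eps|^2 / (1 - (3/4) r)] is strictly below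
    [mu |I_H eps|^2 / (1 - r)], as [I_H eps] is nonzero, so [y_k] passes below
    the latter after finitely many steps; [mu/4 |e_k|^2 <= y_k] then gives the
    claim.

    The analytic part is the skew-symmetry.  A divergence-free field of [V] is
    only known to have a divergence orthogonal to mean-zero functions, so it has
    to be shown that its divergence is zero rather than a constant.  It is an
    L2-limit of divergences of test fields; these have integral zero
    ([integral_pderive_eq0], by induction on the dimension with Fubini's theorem
    and the fundamental theorem of calculus), hence are orthogonal to it, and
    the divergence is orthogonal to itself ([V_div_sqr0]).  For a test field
    [phi], [b(w, phi, phi)] is half the sum of the integrals of
    [w . grad (phi_i^2)], which the weak derivative of [w] turns into integrals
    of [- div w * phi_i^2]; the general case follows by density, since [b] is
    continuous on [X]. *)

(** * Borel sets and boxes in the space of row vectors *)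
Section borel_rV.
Context (R : realType) (n : nat).

Lemma measurable_forall_coord (A : 'I_n -> set R) :
  (forall i, measurable (A i)) ->
  measurable [set x : 'rV[R]_n | forall i, A i (x ord0 i)].
Proof.
move=> mA; rewrite (_ : [set x | _] =
    \bigcap_(i in [set: 'I_n]) [set x : 'rV[R]_n | A i (x ord0 i)]).
  apply: fin_bigcap_measurable => [|i _]; first exact: finite_finset.
  by rewrite -[X in measurable X]setTI; exact: measurable_coord.
by apply/seteqP; split=> [x Ax i _|x Ax i]; exact: Ax.
Qed.

(** Cubes with rational centre and radius [1 / k.+1] form a countable base of
    the topology, and each of them is a finite intersection of coordinate
    conditions. *)
Lemma open_measurable_rV (A : set 'rV[R]_n) : open A -> measurable A.
Proof.
move=> oA; pose B (p : nat * 'rV[rat]_n) :=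
  [set x : 'rV[R]_n | forall i, `|ratr (p.2 ord0 i) - x ord0 i| < p.1.+1%:R^-1].
have mB p : measurable (B p).
  apply: (@measurable_forall_coord
    (fun i => [set y | `|ratr (p.2 ord0 i) - y| < p.1.+1%:R^-1])) => i.
  apply: open_measurable.
  exact: (@ball_open R R (ratr (p.2 ord0 i)) p.1.+1%:R^-1).
rewrite (_ : A = \bigcup_p (if `[< B p `<=` A >] then B p else set0)).
  apply: countable_bigcupT_measurable; first exact: countableP.
  by move=> p; case: ifP.
apply/seteqP; split => [x Ax|x [p _]]; last by case: asboolP => // /[apply].
have /nbhs_ballP[e /= e0 xeA] : nbhs x A by exact: open_nbhs_nbhs.
have e20 : 0 < e / 2 by rewrite divr_gt0.
pose k := Num.truncn (e / 2)^-1.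
have ke : k.+1%:R^-1 < e / 2.
  by rewrite invf_plt ?posrE//; exact: truncnS_gt.
have /choice[q xq] i : exists q : rat, `|ratr q - x ord0 i| < k.+1%:R^-1.
  have [//|z [xz [q _ qz]]] := @dense_rat R (ball (x ord0 i) k.+1%:R^-1) _
    (@ball_open _ R _ _).
    by exists (x ord0 i); apply: ballxx; rewrite invr_gt0.
  by exists q; rewrite qz distrC; exact: xz.
exists (k, \row_i q i) => //; case: asboolP => [_ i|]; first by rewrite /= mxE.
case => y yB; apply: xeA; split => // i j; rewrite ord1 /ball/=.
have := yB j; rewrite /= mxE => yj.
rewrite (le_lt_trans (ler_distD (ratr (q j)) _ _))// (splitr e).
by rewrite ltrD// ?(lt_trans yj)// distrC (lt_trans (xq j)).
Qed.

Lemma continuous_measurable_rV (f : 'rV[R]_n -> R) :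
  continuous f -> measurable_fun setT f.
Proof.
move=> /continuousP cf.
apply: (measurability _ (measurable_realfun.RGenOpens.measurableE R)).
move=> _ [_ [a [b ->] <-]]; rewrite setTI.
by apply: open_measurable_rV; apply: cf; exact: interval_open.
Qed.

Definition box (r : R) := [set x : 'rV[R]_n | forall i, `|x ord0 i| <= r].

Lemma measurable_box r : measurable (box r).
Proof.
apply: (@measurable_forall_coord (fun=> [set y | `|y| <= r])) => i.
rewrite (_ : [set y | _] = `[(- r)%R, r]%classic) ?measurable_itv//.
by apply/seteqP; split => y/=; rewrite in_itv/= ler_norml.
Qed.

Lemma bounded_box (K : set 'rV[R]_n) : bounded_set K ->
  exists r, 0 < r /\ K `<=` box r.
Proof.
move=> [M [_ KM]]; exists (Num.max M 0 + 1); split.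
  by rewrite ltr_pwDr// le_max lexx orbT.
move=> x Kx i; apply: le_trans (KM _ _ x Kx); last by rewrite ltr_pwDr// le_max lexx.
rewrite [leRHS]/Num.norm/= mx_normrE.
by apply: (le_bigmax _ (fun ij => `|x ij.1 ij.2|) (ord0, i)).
Qed.

Lemma compact_box r : compact (box r).
Proof.
apply: (@rV_compact R n (fun=> [set y | `|y| <= r])) => i.
rewrite (_ : [set y | _] = `[(- r)%R, r]%classic); first exact: segment_compact.
by apply/seteqP; split => y/=; rewrite in_itv/= ler_norml.
Qed.

End borel_rV.

Lemma rV_cons0 (R : realType) n (p : 'rV[R]_n * measurableTypeR R) :
  rV_cons p ord0 ord0 = p.2.
Proof.
rewrite /rV_cons (_ : ord0 = lshift n (ord0 : 'I_1)); last exact: val_inj.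
by apply: etrans (row_mxEl _ _ _ _) _; rewrite mxE.
Qed.

Lemma rV_consS (R : realType) n (p : 'rV[R]_n * measurableTypeR R) (i : 'I_n) :
  rV_cons p ord0 (lift ord0 i) = p.1 ord0 i.
Proof.
rewrite /rV_cons (_ : lift ord0 i = rshift 1 i); last exact: val_inj.
exact: row_mxEr.
Qed.

Section lebesgue_rV.
Context (R : realType).
Local Open Scope ereal_scope.

Lemma lebesgue_box_lty n (r : R) : lebesgue_rV R n (box r) < +oo.
Proof.
elim: n => [|n IH] /=; first by rewrite diracE ltry.
have segE : [set y : R | (`|y| <= r)%R] = `[(- r)%R, r]%classic.
  by apply/seteqP; split => y/=; rewrite in_itv/= ler_norml.
have seg_lty : lebesgue_measure (`[(- r)%R, r]%classic : set R) < +oo.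
  by rewrite lebesgue_measure_itv/=; case: ifP; rewrite ?ltry// -EFinB ltry.
rewrite /pushforward.
rewrite (_ : _ @^-1` _ = box r `*` [set y | (`|y| <= r)%R]); last first.
  apply/seteqP; split => [p /= pr|p [pr1 pr2] i].
    split=> /=; last by rewrite -rV_cons0.
    by move=> i; rewrite -rV_consS.
  by case: (unliftP ord0 i) => [j|] ->; rewrite ?rV_consS ?rV_cons0//; exact: pr1.
rewrite segE product_measure1E//; [|exact: measurable_box].
by apply: lte_mul_pinfty => //; rewrite ge0_fin_numE.
Qed.

Lemma lebesgue_rV_sigma_finite n : sigma_finite setT (lebesgue_rV R n).
Proof.
exists (fun k => box k%:R) => [|k]; last first.
  by split; [exact: measurable_box|exact: lebesgue_box_lty].
apply/seteqP; split => // x _.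
have [r [r0 xr]] := @bounded_box R n [set x] (compact_bounded (@compact_set1 _ x)).
exists (Num.truncn r).+1 => // i; rewrite (le_trans (xr x erefl i))// ltW//.
exact: truncnS_gt.
Qed.

End lebesgue_rV.

Lemma integrable_sqr_Lfun2 d (T : measurableType d) (R : realType)
    (mu : {measure set T -> \bar R}) (f : T -> R) :
  measurable_fun setT f -> mu.-integrable setT (fun x => (f x ^+ 2)%:E) ->
  f \in Lfun mu 2%:E.
Proof.
move=> mf if2; rewrite inE; apply/andP; split; rewrite inE//=.
rewrite /finite_norm unlock /Lnorm poweR_lty//.
under eq_integral => x _ do rewrite /= powR_mulrn// real_normK ?num_real//.
exact: integrable_lty.
Qed.

(** * Functions vanishing outside a box *)
Section compact_support.
Context (R : realType) (n : nat).
Implicit Types f g : 'rV[R]_n -> R.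

(** A fixed box plays the role of the compact support: unlike an abstract
    compact set, it is inherited by the slices of a function, which is what the
    induction on the dimension requires. *)
Definition off_box (r : R) f := forall x, ~ box r x -> f x = 0.

Lemma continuous_off_box_bounded r f : continuous f -> off_box r f ->
  exists C, forall x, `|f x| <= C.
Proof.
move=> cf f0.
have [M [_ fM]] : bounded_set (f @` box r).
  apply: compact_bounded; apply: continuous_compact; last exact: compact_box.
  exact: continuous_subspaceT.
exists (Num.max M 0 + 1) => x; have [xr|xr] := pselect (box r x).
  by apply: (fM (Num.max M 0 + 1)); [rewrite ltr_pwDr// le_max lexx|exists x].
by rewrite f0// normr0 addr_ge0// le_max lexx orbT.
Qed.

Lemma continuous_off_box_integrable r f : continuous f -> off_box r f ->
  (lebesgue_rV R n).-integrable setT (EFin \o f).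
Proof.
move=> cf f0; have mf := continuous_measurable_rV cf.
have -> : EFin \o f = (EFin \o f) \_ (box r).
  apply/funext => x; rewrite patchE; case: ifPn => // /negP xr.
  by rewrite /= f0// => ?; apply: xr; rewrite inE.
rewrite -integrable_mkcond; last exact: measurable_box.
apply: measurable_bounded_integrable.
- exact: measurable_box.
- exact: lebesgue_box_lty.
- exact: measurable_funTS.
- have [C fC] := continuous_off_box_bounded cf f0.
  by exists C; split; rewrite ?num_real// => y Cy x _; exact: le_trans (fC x) (ltW Cy).
Qed.

Lemma continuous_off_box_Lfun2 r f : continuous f -> off_box r f ->
  f \in Lfun (lebesgue_rV R n) 2%:E.
Proof.
move=> cf f0; apply: integrable_sqr_Lfun2; first exact: continuous_measurable_rV.
apply: (@continuous_off_box_integrable r) => [|x /f0 fx0].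
  move=> x; under eq_fun do rewrite expr2.
  by apply: continuousM; exact: cf.
by rewrite fx0 expr0n.
Qed.

Lemma pderive_off_box r f (j : 'I_n) : off_box r f -> off_box r (pderive j f).
Proof.
move=> f0 x xr; rewrite /pderive -(derive_cst (0 : R) x (delta_mx ord0 j)).
apply: near_eq_derive.
have cb : closed (box (n := n) r).
  by apply: compact_closed; [exact: norm_hausdorff|exact: compact_box].
have : nbhs x (~` box r).
  by apply: open_nbhs_nbhs; split => //; exact: closed_openC.
by apply: filterS => y yr; rewrite f0.
Qed.

End compact_support.

(** * Slices of a function of several variables *)
Section rV_cons_slices.
Context (R : realType) (n : nat).

Let coordDZ m (x y : 'rV[R]_m) (h : R) i :
  (h *: x + y) ord0 i = h * x ord0 i + y ord0 i.
Proof. by rewrite !mxE. Qed.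

Lemma rV_consDZ (y : 'rV[R]_n) (t h : R) :
  h *: delta_mx ord0 ord0 + rV_cons (y, t) = rV_cons (y, h + t).
Proof.
apply/rowP => i; rewrite coordDZ [X in h * X]mxE.
case: (unliftP ord0 i) => [j|] ->.
  by rewrite !rV_consS/= mulr0 add0r.
by rewrite !rV_cons0/= mulr1.
Qed.

Lemma rV_consSDZ (y : 'rV[R]_n) (t h : R) j :
  h *: delta_mx ord0 (lift ord0 j) + rV_cons (y, t) =
  rV_cons (h *: delta_mx ord0 j + y, t).
Proof.
apply/rowP => i; rewrite coordDZ [X in h * X]mxE.
case: (unliftP ord0 i) => [k|] ->.
  by rewrite !rV_consS/= coordDZ mxE (inj_eq (@lift_inj _ _)).
by rewrite !rV_cons0/= mulr0 add0r.
Qed.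

Lemma continuous_rV_consl (t : R) : continuous (fun y : 'rV[R]_n => rV_cons (y, t)).
Proof.
move=> y A /nbhs_ballP[e /= e0 yeA]; apply/nbhs_ballP; exists e => //= z [_ yz].
apply: yeA; split => // i j; rewrite ord1.
case: (unliftP ord0 j) => [k|] ->; first by rewrite !rV_consS; exact: yz.
by rewrite !rV_cons0; exact: ballxx.
Qed.

Lemma continuous_rV_consr (y : 'rV[R]_n) : continuous (fun t : R => rV_cons (y, t)).
Proof.
move=> t A /nbhs_ballP[e /= e0 yeA]; apply/nbhs_ballP; exists e => //= s ts.
apply: yeA; split => // i j; rewrite ord1.
case: (unliftP ord0 j) => [k|] ->; last by rewrite !rV_cons0.
by rewrite !rV_consS; exact: ballxx.
Qed.

End rV_cons_slices.

(** Fubini's theorem asks for a sigma-finite measure structure; this alias of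
    Lebesgue measure carries it. *)
Definition lebesgue_rV_sf (R : realType) (n : nat) :
  set 'rV[R]_n -> \bar R := lebesgue_rV R n.
HB.instance Definition _ R n := Measure.on (@lebesgue_rV_sf R n).
HB.instance Definition _ R n := Measure_isSigmaFinite.Build _ _ _
  (@lebesgue_rV_sf R n) (lebesgue_rV_sigma_finite R n).

(** * Fubini's theorem and integrals of partial derivatives *)
Section fubini.
Context (R : realType) (n : nat).
Implicit Types f : 'rV[R]_n.+1 -> R.
Local Open Scope ereal_scope.

Let cons_integrable f r : continuous f -> off_box r f ->
  (@lebesgue_rV_sf R n \x @lebesgue_measure R).-integrable setT
    (EFin \o f \o @rV_cons R n).
Proof.
move=> cf f0.
have mf : measurable_fun setT (EFin \o f).
  by apply/measurable_EFinP; exact: continuous_measurable_rV.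
apply/integrableP; split.
  by apply: measurableT_comp => //; exact: measurable_rV_cons.
have /integrableP[_] := continuous_off_box_integrable cf f0.
rewrite ge0_integral_pushforward//.
  exact: measurable_rV_cons.
exact: measurableT_comp.
Qed.

Let integral_cons f r : continuous f -> off_box r f ->
  \int[lebesgue_rV R n.+1]_x (f x)%:E =
  \int[@lebesgue_rV_sf R n \x @lebesgue_measure R]_p (f (rV_cons p))%:E.
Proof.
move=> cf f0; rewrite integral_pushforward//.
- exact: measurable_rV_cons.
- by apply/measurable_EFinP; exact: continuous_measurable_rV.
- exact: (cons_integrable cf f0).
Qed.

Lemma integral_rV_cons12 f r : continuous f -> off_box r f ->
  \int[lebesgue_rV R n.+1]_x (f x)%:E =
  \int[lebesgue_rV R n]_y \int[lebesgue_measure]_t (f (rV_cons (y, t)))%:E.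
Proof.
move=> cf f0; rewrite (integral_cons cf f0).
by rewrite -(integral12_prod_meas1 (cons_integrable cf f0)).
Qed.

Lemma integral_rV_cons21 f r : continuous f -> off_box r f ->
  \int[lebesgue_rV R n.+1]_x (f x)%:E =
  \int[lebesgue_measure]_t \int[lebesgue_rV R n]_y (f (rV_cons (y, t)))%:E.
Proof.
move=> cf f0; rewrite (integral_cons cf f0).
by rewrite -(integral21_prod_meas1 (cons_integrable cf f0)).
Qed.

End fubini.

Lemma integral_derive1_eq0 (R : realType) (r : R) (g : R -> R) :
  (forall t, derivable g t 1) -> continuous (fun t => 'D_1 g t) ->
  (forall t, r < `|t| -> g t = 0) ->
  (\int[lebesgue_measure]_t ('D_1 g t)%:E = 0)%E.
Proof.
move=> dg cg g0; pose a := Num.max r 0 + 1.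
have ra : r < a by rewrite ltr_pwDr// le_max lexx.
have a0 : 0 < a by rewrite ltr_pwDr// le_max lexx orbT.
have -> : (fun t => ('D_1 g t)%:E) = ((fun t => ('D_1 g t)%:E) \_ `[- a, a]).
  apply/funext => t; rewrite patchE; case: ifPn => //.
  rewrite mem_setE in_itv/= -ler_norml -ltNge => ta.
  apply: (congr1 EFin); rewrite -(derive_cst (0 : R) t 1); apply: near_eq_derive.
  have : nbhs t [set s | a < `|s|].
    apply: open_nbhs_nbhs; split => //.
    apply: (@open_comp _ _ (fun s : R => `|s|) [set y | a < y]); last exact: open_gt.
    by move=> x _; exact: norm_continuous.
  by apply: filterS => s sa; rewrite g0// (lt_trans ra).
rewrite -integral_mkcond (@continuous_FTC2 R (fun t => 'D_1 g t) g).
- by rewrite !g0 ?normrN ?gtr0_norm// subee.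
- by rewrite gtrN.
- exact: continuous_subspaceT.
- have gc : continuous g.
    by move=> t; apply: differentiable_continuous; exact/derivable1_diffP.
  by split=> [t _||]; [exact: dg|apply: cvg_at_right_filter; exact: gc|
    apply: cvg_at_left_filter; exact: gc].
- by move=> t _; rewrite derive1E.
Qed.

(** The integral along the first coordinate and that along the remaining ones
    may be taken in either order.  Integrating first along the direction of
    derivation leaves a derivative of a slice: the fundamental theorem of
    calculus settles the first direction, the induction hypothesis the others.
    Only differentiability in the direction of derivation is assumed, so that
    the hypotheses pass to slices. *)
Lemma integral_pderive_eq0 (R : realType) (n : nat) (r : R) (j : 'I_n)
    (f : 'rV[R]_n -> R) :
  (forall x, derivable f x (delta_mx ord0 j)) -> continuous (pderive j f) ->
  off_box r f -> (\int[lebesgue_rV R n]_x (pderive j f x)%:E = 0)%E.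
Proof.
elim: n j f => [[]//|n IH] j f df cf f0.
have f'0 := pderive_off_box j f0.
case: (unliftP ord0 j) => [k|] jE; subst j.
- rewrite (integral_rV_cons21 cf f'0) integral0_eq// => t _.
  pose g y := f (rV_cons (y, t)).
  have quotE y : (fun h => h^-1 *: ((f \o shift (rV_cons (y, t)))
      (h *: delta_mx ord0 (lift ord0 k)) - f (rV_cons (y, t)))) =
      (fun h => h^-1 *: ((g \o shift y) (h *: delta_mx ord0 k) - g y)).
    by apply/funext => h; rewrite /= rV_consSDZ.
  have gE y : pderive (lift ord0 k) f (rV_cons (y, t)) = pderive k g y.
    by rewrite /pderive /derive quotE.
  under eq_integral do rewrite gE; apply: IH.
  + by move=> y; rewrite /derivable -quotE; exact: df.
  + rewrite (_ : pderive k g = pderive (lift ord0 k) f \o (fun y => rV_cons (y, t))).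
      by move=> y; apply: continuous_comp; [exact: continuous_rV_consl|exact: cf].
    by apply/funext => y; rewrite /= gE.
  + by move=> y yr; apply: f0 => fr; apply: yr => i; rewrite -(rV_consS (y, t)).
- rewrite (integral_rV_cons12 cf f'0) integral0_eq// => y _.
  pose g t := f (rV_cons (y, t)).
  have quotE t : (fun h => h^-1 *: ((f \o shift (rV_cons (y, t)))
      (h *: delta_mx ord0 ord0) - f (rV_cons (y, t)))) =
      (fun h => h^-1 *: ((g \o shift t) (h *: 1) - g t)).
    by apply/funext => h; rewrite /= rV_consDZ /g scaler1.
  have gE t : pderive ord0 f (rV_cons (y, t)) = 'D_1 g t.
    by rewrite /pderive /derive quotE.
  under eq_integral do rewrite gE; apply: (@integral_derive1_eq0 R r).
  + by move=> t; rewrite /derivable -quotE; exact: df.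
  + rewrite (_ : (fun t => _) = pderive ord0 f \o (fun t => rV_cons (y, t))).
      by move=> t; apply: continuous_comp; [exact: continuous_rV_consr|exact: cf].
    by apply/funext => t; rewrite /= gE.
  + move=> t tr; apply: f0 => fr; move: tr; apply/negP; rewrite -leNgt.
    by rewrite -[t](rV_cons0 (y, t)).
Qed.

(** * The inner product of square-integrable matrix fields *)
Section square_integrable.
Context (R : realType) (d : nat) (Omega : set 'rV[R]_d).
Hypothesis mO : measurable Omega.
Notation E := 'rV[R]_d.
Notation leb := (lebesgue_rV R d).

Definition in_L2 (f : E -> R) := f \_ Omega \in Lfun leb 2%:E.

Let one_le2 : (1 <= 2%:E :> \bar R)%E.
Proof. by rewrite lee_fin ler1n. Qed.

Lemma in_L2_lin (a : R) (f g : E -> R) :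
  in_L2 f -> in_L2 g -> in_L2 (fun x => a * f x + g x).
Proof.
move=> f2 g2; rewrite /in_L2.
rewrite (_ : _ \_ _ = a *: (f \_ Omega) + (g \_ Omega)).
  exact: (Lfun_submod_closed leb one_le2).2.
apply/funext => x; rewrite /= !fctE !patchE; case: ifPn => // _.
by rewrite scaler0 addr0.
Qed.

Lemma in_L2_0 : in_L2 (fun=> 0).
Proof.
rewrite /in_L2 (_ : _ \_ _ = 0); last by apply/funext => x; rewrite patchE; case: ifP.
exact: (Lfun_submod_closed leb one_le2).1.
Qed.

Lemma in_L2_mul_integrable (f g : E -> R) : in_L2 f -> in_L2 g ->
  leb.-integrable Omega (EFin \o (fun x => f x * g x)).
Proof.
move=> f2 g2; rewrite integrable_mkcond//.
have /Lfun1_integrable := Lfun2_mul_Lfun1 f2 g2; congr (_.-integrable _ _).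
by apply/funext => x; rewrite /= !patchE; case: ifPn => //= _; rewrite mulr0.
Qed.

Section matrix_fields.
Context (m n : nat).
Implicit Types A B C : E -> 'M[R]_(m, n).

Definition contract A B (x : E) : R := \sum_i \sum_j A x i j * B x i j.

Lemma contract_integrable A B : in_Lp Omega 2%:E A -> in_Lp Omega 2%:E B ->
  leb.-integrable Omega (EFin \o contract A B).
Proof.
move=> A2 B2.
rewrite (_ : EFin \o _ = fun x => (\sum_i \sum_j (A x i j * B x i j)%:E)%E).
  apply: integrable_sum => // i _; apply: integrable_sum => // j _.
  exact: in_L2_mul_integrable (A2 i j) (B2 i j).
by apply/funext => x; rewrite /= /contract -sumEFin; apply: eq_bigr => i _;
  rewrite sumEFin.
Qed.

Let linDZE a A B x i j : (a *: A + B) x i j = a * A x i j + B x i j.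
Proof. by rewrite -[LHS]/((a *: A x + B x) i j) !mxE. Qed.

Lemma in_Lp2_lin a A B : in_Lp Omega 2%:E A -> in_Lp Omega 2%:E B ->
  in_Lp Omega 2%:E (a *: A + B).
Proof.
move=> A2 B2 i j.
have -> : (fun x => (a *: A + B) x i j) = (fun x => a * A x i j + B x i j).
  by apply/funext => x; exact: linDZE.
exact: (in_L2_lin a (A2 i j) (B2 i j)).
Qed.

Lemma in_Lp2_sub A B : in_Lp Omega 2%:E A -> in_Lp Omega 2%:E B ->
  in_Lp Omega 2%:E (A - B).
Proof.
by move=> A2 B2; rewrite addrC -scaleN1r; exact: in_Lp2_lin.
Qed.

Lemma innerC A B : inner Omega A B = inner Omega B A.
Proof.
apply: eq_Rintegral => x _; apply: eq_bigr => i _; apply: eq_bigr => j _.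
exact: mulrC.
Qed.

Lemma inner_linl a A B C : in_Lp Omega 2%:E A -> in_Lp Omega 2%:E B ->
  in_Lp Omega 2%:E C ->
  inner Omega (a *: A + B) C = a * inner Omega A C + inner Omega B C.
Proof.
move=> A2 B2 C2; rewrite /inner.
have iA := contract_integrable A2 C2; have iB := contract_integrable B2 C2.
transitivity (\int[leb]_(x in Omega) (a * contract A C x + contract B C x)).
  apply: eq_Rintegral => x _; rewrite /contract mulr_sumr -big_split/=.
  apply: eq_bigr => i _; rewrite mulr_sumr -big_split/=; apply: eq_bigr => j _.
  by rewrite linDZE mulrDl mulrA.
rewrite RintegralD ?RintegralZl//.
exact: (integrableZl mO a iA).
Qed.

Lemma inner_linr a A B C : in_Lp Omega 2%:E A -> in_Lp Omega 2%:E B ->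
  in_Lp Omega 2%:E C ->
  inner Omega C (a *: A + B) = a * inner Omega C A + inner Omega C B.
Proof. by move=> A2 B2 C2; rewrite !(innerC C) inner_linl. Qed.

Lemma inner_ge0 A : 0 <= inner Omega A A.
Proof.
apply: Rintegral_ge0 => x _; apply: sumr_ge0 => i _; apply: sumr_ge0 => j _.
by rewrite -expr2 sqr_ge0.
Qed.

Lemma normL2_ge0 A : 0 <= normL2 Omega A.
Proof. exact: sqrtr_ge0. Qed.

Lemma sqr_normL2 A : normL2 Omega A ^+ 2 = inner Omega A A.
Proof. by rewrite sqr_sqrtr// inner_ge0. Qed.

Lemma sqr_normL2_lin a A B : in_Lp Omega 2%:E A -> in_Lp Omega 2%:E B ->
  normL2 Omega (a *: A + B) ^+ 2 =
  a ^+ 2 * normL2 Omega A ^+ 2 + 2 * a * inner Omega A B + normL2 Omega B ^+ 2.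
Proof.
move=> A2 B2; have AB2 := in_Lp2_lin a A2 B2.
rewrite !sqr_normL2 inner_linl// !inner_linr// (innerC B A); ring.
Qed.

(** [|t A + B|^2] is a nonnegative quadratic polynomial in [t]. *)
Lemma cauchy_schwarz A B : in_Lp Omega 2%:E A -> in_Lp Omega 2%:E B ->
  inner Omega A B <= normL2 Omega A * normL2 Omega B.
Proof.
move=> A2 B2.
have P t : 0 <= t ^+ 2 * normL2 Omega A ^+ 2 + 2 * t * inner Omega A B +
    normL2 Omega B ^+ 2.
  by rewrite -sqr_normL2_lin// sqr_ge0.
move: P (normL2_ge0 A) (normL2_ge0 B).
move: (normL2 Omega A) (normL2 Omega B) (inner Omega A B) => a b c P a0 b0.
have [a_eq0|a_neq0] := eqVneq a 0.
  rewrite a_eq0 mul0r leNgt; apply/negP => c0.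
  (* Without its quadratic term, the polynomial is affine in [t]; it equals
     [- b ^+ 2 - 2] at this point. *)
  have := P (- (b ^+ 2 + 1) / c); rewrite a_eq0.
  rewrite (_ : _ + _ = - b ^+ 2 - 2); last by field; rewrite gt_eqF.
  by rewrite leNgt; apply/negP/negPn; nra.
(* The minimum of the polynomial is attained at this point. *)
have := P (- c / a ^+ 2).
rewrite (_ : _ + _ = (a ^+ 2)^-1 * ((a * b) ^+ 2 - c ^+ 2)); last by field.
rewrite pmulr_rge0 ?invr_gt0 ?exprn_even_gt0// subr_ge0 => cab.
rewrite (le_trans (ler_norm c))// -(@ler_pXn2r _ 2)// ?nnegrE ?mulr_ge0//.
by rewrite real_normK ?num_real.
Qed.

Lemma normL2N A : normL2 Omega (- A) = normL2 Omega A.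
Proof.
congr Num.sqrt; apply: eq_Rintegral => x _; apply: eq_bigr => i _.
by apply: eq_bigr => j _; rewrite -![(- A) x i j]/((- A x) i j) !mxE mulrNN.
Qed.

Lemma normL2Z a A : in_Lp Omega 2%:E A -> normL2 Omega (a *: A) = `|a| * normL2 Omega A.
Proof.
move=> A2; have Z2 : in_Lp Omega 2%:E (0 : E -> 'M[R]_(m, n)).
  move=> i j; have -> : (fun x => (0 : E -> 'M[R]_(m, n)) x i j) = (fun=> 0).
      by apply/funext => x; rewrite -[LHS]/((0 : 'M[R]_(m, n)) i j) mxE.
    exact: in_L2_0.
rewrite -[a *: A]addr0; apply/eqP; rewrite -(@eqrXn2 _ 2)//.
  rewrite sqr_normL2_lin// exprMn real_normK ?num_real//.
  have -> : inner Omega A 0 = 0.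
    by have := inner_linr 1 Z2 Z2 A2; rewrite scale1r addr0; lra.
  have -> : normL2 Omega (0 : E -> 'M[R]_(m, n)) = 0.
    rewrite /normL2; have := inner_linr 1 Z2 Z2 Z2.
    by rewrite scale1r addr0 => h; rewrite (_ : inner _ _ _ = 0) ?sqrtr0//; lra.
  by rewrite mulr0 !addr0 expr0n addr0.
- exact: normL2_ge0.
- by rewrite mulr_ge0 ?normL2_ge0.
Qed.

Lemma ler_normL2D A B : in_Lp Omega 2%:E A -> in_Lp Omega 2%:E B ->
  normL2 Omega (A + B) <= normL2 Omega A + normL2 Omega B.
Proof.
move=> A2 B2; rewrite -(@ler_pXn2r _ 2)// ?nnegrE ?addr_ge0 ?normL2_ge0//.
rewrite -[A]scale1r sqr_normL2_lin// scale1r sqrrD.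
have := cauchy_schwarz A2 B2; lra.
Qed.

End matrix_fields.
End square_integrable.

(** * Smooth functions and test functions *)
Section smooth_functions.
Context (R : realType) (d : nat).
Notation E := 'rV[R]_d.
Implicit Types f g : E -> R.

Lemma pderive_lin (j : 'I_d) a f g :
  (forall x, differentiable f x) -> (forall x, differentiable g x) ->
  pderive j (fun x => a * f x + g x) =
    (fun x => a * pderive j f x + pderive j g x).
Proof.
move=> df dg; apply/funext => x; rewrite /pderive.
have -> : (fun y => a * f y + g y) = (a \*: f) + g by [].
have df' : derivable f x (delta_mx ord0 j) by exact: diff_derivable.
have dg' : derivable g x (delta_mx ord0 j) by exact: diff_derivable.
by rewrite (deriveD (derivableZ df') dg') (deriveZ _ df').
Qed.

Lemma pderive_mul (j : 'I_d) f g :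
  (forall x, differentiable f x) -> (forall x, differentiable g x) ->
  pderive j (fun x => f x * g x) =
    (fun x => f x * pderive j g x + g x * pderive j f x).
Proof.
move=> df dg; apply/funext => x; rewrite /pderive.
have -> : (fun y => f y * g y) = f * g by [].
by rewrite deriveM//; exact: diff_derivable.
Qed.

Lemma continuous_lin a f g : continuous f -> continuous g ->
  continuous (fun x => a * f x + g x).
Proof.
move=> cf cg x; apply: (@continuousD _ _ _ (fun x => a * f x) g) (cg x).
by apply: (@continuousM _ _ (cst a) f) (cf x); exact: cst_continuous.
Qed.

Lemma Ck_continuous k f : Ck k f -> continuous f.
Proof. by case: k => //= k [df _] x; exact: differentiable_continuous. Qed.

Lemma CkW k f : Ck k.+1 f -> Ck k f.
Proof.
elim: k f => [|k IH] f; first exact: (@Ck_continuous 1).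
by move=> -[df dCk]; split => // j; exact/IH/dCk.
Qed.

Lemma Ck_lin k a f g : Ck k f -> Ck k g -> Ck k (fun x => a * f x + g x).
Proof.
elim: k f g => [|k IH] f g; first exact: continuous_lin.
move=> [df kf] [dg kg]; split.
  by move=> x; apply: differentiableD => //; exact: differentiableZ.
by move=> j; rewrite pderive_lin//; exact: IH (kf j) (kg j).
Qed.

Lemma Ck_mul k f g : Ck k f -> Ck k g -> Ck k (fun x => f x * g x).
Proof.
elim: k f g => [|k IH] f g.
  by move=> cf cg x; exact: continuousM (cf x) (cg x).
move=> /[dup] /CkW f_k [df kf] /[dup] /CkW g_k [dg kg]; split.
  by move=> x; exact: differentiableM.
move=> j; rewrite pderive_mul//.
under eq_fun do rewrite -[f _ * _]mul1r.
by apply: Ck_lin; [exact: IH f_k (kg j)|exact: IH g_k (kf j)].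
Qed.

Lemma smooth_differentiable f : smooth f -> forall x, differentiable f x.
Proof. by move=> /(_ 1) []. Qed.

Lemma smooth_continuous f : smooth f -> continuous f.
Proof. exact: (fun h => h 0). Qed.

Variable Omega : set E.

Lemma test_lin a f g : test_function Omega f -> test_function Omega g ->
  test_function Omega (fun x => a * f x + g x).
Proof.
move=> [sf [K [cK KO fK]]] [sg [L [cL LO gL]]]; split.
  by move=> k; exact: Ck_lin.
exists (K `|` L); split; [exact: compactU|by rewrite subUset|].
by move=> x /not_orP[xK xL]; rewrite fK// gL// mulr0 addr0.
Qed.

Lemma test_mul f g : test_function Omega f -> test_function Omega g ->
  test_function Omega (fun x => f x * g x).
Proof.
move=> [sf [K [cK KO fK]]] [sg _]; split; first by move=> k; exact: Ck_mul.
by exists K; split => // x xK; rewrite fK// mul0r.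
Qed.

Lemma test_pderive j f : test_function Omega f -> test_function Omega (pderive j f).
Proof.
move=> [sf [K [cK KO fK]]]; split; first by move=> k; exact: (sf k.+1).2.
exists K; split => // x xK.
rewrite /pderive -(derive_cst (0 : R) x (delta_mx ord0 j)).
apply: near_eq_derive.
have clK : closed K by apply: compact_closed => //; exact: norm_hausdorff.
have : nbhs x (~` K) by apply: open_nbhs_nbhs; split => //; exact: closed_openC.
by apply: filterS => y yK; rewrite fK.
Qed.

Lemma test_off_box f : test_function Omega f -> exists r, off_box r f.
Proof.
move=> [_ [K [cK _ fK]]]; have [r [_ Kr]] := bounded_box (compact_bounded cK).
by exists r => x xr; apply: fK => /Kr.
Qed.

Lemma test_restrict f : test_function Omega f -> f \_ Omega = f.
Proof.
move=> [_ [K [_ KO fK]]]; apply/funext => x; rewrite patchE; case: ifPn => // xO.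
by rewrite fK// => /KO; move: xO; rewrite notin_setE.
Qed.

Lemma test_in_L2 f : test_function Omega f -> in_L2 Omega f.
Proof.
move=> tf; rewrite /in_L2 test_restrict//.
have [r fr] := test_off_box tf.
exact: continuous_off_box_Lfun2 (smooth_continuous tf.1) fr.
Qed.

Hypothesis mO : measurable Omega.
Notation leb := (lebesgue_rV R d).

Lemma test_integrable f : test_function Omega f -> leb.-integrable Omega (EFin \o f).
Proof.
move=> tf; rewrite integrable_mkcond// restrict_EFin test_restrict//.
have [r fr] := test_off_box tf.
exact: continuous_off_box_integrable (smooth_continuous tf.1) fr.
Qed.

Lemma Rintegral_pderive_test j f : test_function Omega f ->
  \int[leb]_(x in Omega) pderive j f x = 0.
Proof.
move=> tf; rewrite Rintegral_mkcond (test_restrict (test_pderive j tf)).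
have [r fr] := test_off_box tf.
rewrite /Rintegral (@integral_pderive_eq0 _ _ r)//.
- by move=> x; apply: diff_derivable; exact: smooth_differentiable tf.1 x.
- exact: smooth_continuous (test_pderive j tf).1.
Qed.

(** The product [f * g] is again a test function, so the integral of its
    derivative vanishes. *)
Lemma test_by_parts j f g : test_function Omega f -> test_function Omega g ->
  \int[leb]_(x in Omega) (f x * pderive j g x) =
  - \int[leb]_(x in Omega) (pderive j f x * g x).
Proof.
move=> tf tg; apply/eqP; rewrite -addr_eq0; apply/eqP.
rewrite -(Rintegral_pderive_test j (test_mul tf tg)).
rewrite pderive_mul; [|exact: smooth_differentiable tf.1
                      |exact: smooth_differentiable tg.1].
rewrite RintegralD//.
- by congr (_ + _); apply: eq_Rintegral => x _; rewrite mulrC.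
- exact: test_integrable (test_mul tf (test_pderive j tg)).
- exact: test_integrable (test_mul tg (test_pderive j tf)).
Qed.

End smooth_functions.

(** * The Sobolev spaces of velocity fields *)
Lemma Rintegral_sum d (T : measurableType d) (R : realType)
    (mu : {measure set T -> \bar R}) (D : set T) (I : Type) (s : seq I)
    (F : I -> T -> R) :
  measurable D -> (forall i, mu.-integrable D (EFin \o F i)) ->
  \int[mu]_(x in D) (\sum_(i <- s) F i x) = \sum_(i <- s) \int[mu]_(x in D) F i x.
Proof.
move=> mD iF; elim: s => [|i s IH].
  rewrite big_nil; under eq_Rintegral do rewrite big_nil.
  by rewrite Rintegral_cst// mul0r.
rewrite big_cons -IH -RintegralD//.
  by apply: eq_Rintegral => x _; rewrite big_cons.
have -> : EFin \o (fun x => \sum_(j <- s) F j x) =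
    (fun x => \sum_(j <- s) (F j x)%:E)%E by apply/funext => x; rewrite /= sumEFin.
by apply: integrable_sum => // j _; exact: iF.
Qed.

Section sobolev_fields.
Context (R : realType) (d : nat) (Omega : set 'rV[R]_d).
Hypothesis mO : measurable Omega.
Notation E := 'rV[R]_d.
Notation leb := (lebesgue_rV R d).
Notation field := (sobolev_field R d).
Implicit Types u v w : field.

Lemma H1_lin a v w : H1 Omega v -> H1 Omega w -> H1 Omega (a *: v + w).
Proof.
move=> [v1 v2 vw] [w1 w2 ww]; split.
- exact: in_Lp2_lin.
- exact: in_Lp2_lin.
move=> i j phi tphi; have pd := test_in_L2 (test_pderive j tphi).
have p2 := test_in_L2 tphi.
have iv1 := in_L2_mul_integrable mO (v1 ord0 i) pd.
have iw1 := in_L2_mul_integrable mO (w1 ord0 i) pd.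
have iv2 := in_L2_mul_integrable mO (v2 i j) p2.
have iw2 := in_L2_mul_integrable mO (w2 i j) p2.
transitivity (\int[leb]_(x in Omega) (a * (v.1 x ord0 i * pderive j phi x) +
                                      w.1 x ord0 i * pderive j phi x)).
  apply: eq_Rintegral => x _.
  by rewrite -[(a *: v + w).1 x]/(a *: v.1 x + w.1 x) !mxE mulrDl mulrA.
rewrite RintegralD//; last exact: (integrableZl mO a iv1).
rewrite RintegralZl// vw// ww// mulrN -opprD -RintegralZl// -RintegralD//.
  congr (- _); apply: eq_Rintegral => x _.
  by rewrite -[(a *: v + w).2 x]/(a *: v.2 x + w.2 x) !mxE mulrDl mulrA.
exact: (integrableZl mO a iv2).
Qed.

Definition test_field (phi : E -> E) :=
  forall i, test_function Omega (fun x => phi x ord0 i).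

Lemma test_field_in_L2 phi : test_field phi -> in_Lp Omega 2%:E phi.
Proof. by move=> tphi i j; rewrite ord1; exact: test_in_L2 (tphi j). Qed.

Lemma jacobian_ofE (phi : E -> E) x i j :
  jacobian_of phi x i j = pderive j (fun y => phi y ord0 i) x.
Proof. by rewrite mxE. Qed.

Lemma jacobian_in_L2 phi : test_field phi -> in_Lp Omega 2%:E (jacobian_of phi).
Proof.
move=> tphi i j.
have -> : (fun x => jacobian_of phi x i j) = pderive j (fun y => phi y ord0 i).
  by apply/funext => x; exact: jacobian_ofE.
exact: test_in_L2 (test_pderive j (tphi i)).
Qed.

Lemma test_field_lin a phi psi : test_field phi -> test_field psi ->
  test_field (a *: phi + psi).
Proof.
move=> tphi tpsi i; have := test_lin a (tphi i) (tpsi i).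
congr test_function; apply/funext => x.
by rewrite -[(a *: phi + psi) x]/(a *: phi x + psi x) !mxE.
Qed.

Lemma jacobian_of_lin a phi psi : test_field phi -> test_field psi ->
  jacobian_of (a *: phi + psi) = a *: jacobian_of phi + jacobian_of psi.
Proof.
move=> tphi tpsi; apply/funext => x; apply/matrixP => i j.
rewrite -[RHS]/((a *: jacobian_of phi x + jacobian_of psi x) i j).
rewrite 3!mxE !jacobian_ofE.
have -> : (fun y => (a *: phi + psi) y ord0 i) =
    (fun y => a * phi y ord0 i + psi y ord0 i).
  by apply/funext => y; rewrite -[LHS]/((a *: phi y + psi y) ord0 i) !mxE.
have dphi := smooth_differentiable (tphi i).1.
have dpsi := smooth_differentiable (tpsi i).1.
by rewrite (pderive_lin j a dphi dpsi).
Qed.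

Lemma test_field_X phi : test_field phi -> X Omega (phi, jacobian_of phi).
Proof.
move=> tphi; split=> [|e e0].
  split; [exact: test_field_in_L2|exact: jacobian_in_L2|move=> i j psi tpsi /=].
  rewrite test_by_parts//; congr (- _); apply: eq_Rintegral => x _.
  by rewrite jacobian_ofE.
have norm0 m n : normL2 Omega (0 : E -> 'M[R]_(m, n)) = 0.
  rewrite /normL2 /inner (@eq_Rintegral _ _ _ _ _ (fun=> 0)).
    by rewrite Rintegral_cst// mul0r sqrtr0.
  move=> x _; rewrite big1// => i _; rewrite big1// => j _.
  by rewrite -[(0 : E -> 'M[R]_(m, n)) x]/(0 : 'M[R]_(m, n)) mxE mul0r.
by exists phi; split => //; rewrite /= subrr norm0.
Qed.

Lemma X_approx v (e : R) : X Omega v -> 0 < e -> exists phi,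
  [/\ test_field phi, normL2 Omega (v.1 - phi) < e &
      normL2 Omega (v.2 - jacobian_of phi) < e].
Proof. by move=> [_ /[apply]]. Qed.

Let normL2_lin m n a (A B : E -> 'M[R]_(m, n)) e :
  in_Lp Omega 2%:E A -> in_Lp Omega 2%:E B ->
  normL2 Omega A < e / (2 * (`|a| + 1)) -> normL2 Omega B < e / 2 ->
  normL2 Omega (a *: A + B) < e.
Proof.
move=> A2 B2 Ae Be; have aA2 : in_Lp Omega 2%:E (a *: A).
  by rewrite -[_ *: _](addrK B); apply: in_Lp2_sub => //; exact: in_Lp2_lin.
apply: (le_lt_trans (ler_normL2D mO aA2 B2)); rewrite normL2Z//.
move: Ae; rewrite ltr_pdivlMr ?mulr_gt0// ?ltr_wpDl// => Ae.
have := normL2_ge0 Omega A; have := normr_ge0 a; nra.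
Qed.

Lemma X_lin a v w : X Omega v -> X Omega w -> X Omega (a *: v + w).
Proof.
move=> Xv Xw; split; first exact: H1_lin Xv.1 Xw.1.
move=> e e0; have a0 : 0 < 2 * (`|a| + 1) by rewrite mulr_gt0// ltr_wpDl.
have [phi [tphi vphi1 vphi2]] := X_approx Xv (divr_gt0 e0 a0).
have [psi [tpsi wpsi1 wpsi2]] := X_approx Xw (divr_gt0 e0 (ltr0Sn R 1)).
have lin_sub m n (A A' B B' : E -> 'M[R]_(m, n)) :
    a *: A + B - (a *: A' + B') = a *: (A - A') + (B - B').
  by rewrite scalerBr opprD addrACA.
have [[v1 v2 _] _] := Xv; have [[w1 w2 _] _] := Xw.
exists (a *: phi + psi); split; first exact: test_field_lin.
- rewrite lin_sub; apply: normL2_lin => //;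
    by apply: in_Lp2_sub => //; exact: test_field_in_L2.
- rewrite jacobian_of_lin// lin_sub; apply: normL2_lin => //;
    by apply: in_Lp2_sub => //; exact: jacobian_in_L2.
Qed.

Lemma tr_in_L2 (A : E -> 'M[R]_d) :
  in_Lp Omega 2%:E A -> in_L2 Omega (fun x => \tr (A x)).
Proof.
move=> A2; rewrite (_ : (fun x => \tr (A x)) = fun x => \sum_i A x i i)//.
elim: (index_enum _) => [|i s IH].
  by under eq_fun do rewrite big_nil; exact: in_L2_0.
under eq_fun do rewrite big_cons -[A _ i i]mul1r.
exact: (in_L2_lin 1 (A2 i i) IH).
Qed.

Lemma V_lin a v w : V Omega v -> V Omega w -> V Omega (a *: v + w).
Proof.
move=> [Xv dv] [Xw dw]; split; first exact: X_lin.
move=> q Qq; have q2 : in_L2 Omega q by case: Qq.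
have [[_ v2 _] _] := Xv; have [[_ w2 _] _] := Xw.
have iv := in_L2_mul_integrable mO (tr_in_L2 v2) q2.
have iw := in_L2_mul_integrable mO (tr_in_L2 w2) q2.
transitivity (\int[leb]_(x in Omega) (a * (\tr (v.2 x) * q x) + \tr (w.2 x) * q x)).
  apply: eq_Rintegral => x _.
  by rewrite -[(a *: v + w).2 x]/(a *: v.2 x + w.2 x) linearP/= mulrDl mulrA.
rewrite RintegralD//; last exact: (integrableZl mO a iv).
by rewrite RintegralZl// dv// dw// mulr0 addr0.
Qed.

End sobolev_fields.

(** * Solenoidal fields and the skew-symmetry of convection *)
Section solenoidal.
Context (R : realType) (d : nat) (Omega : set 'rV[R]_d).
Hypothesis mO : measurable Omega.
Notation E := 'rV[R]_d.
Notation leb := (lebesgue_rV R d).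
Notation field := (sobolev_field R d).
Implicit Types u v w : field.

Lemma div_test_Q (phi : E -> E) : test_field Omega phi ->
  Q Omega (fun x => \tr (jacobian_of phi x)).
Proof.
move=> tphi.
have trE : (fun x => \tr (jacobian_of phi x)) =
    fun x => \sum_i pderive i (fun y => phi y ord0 i) x.
  by apply/funext => x; apply: eq_bigr => i _; exact: jacobian_ofE.
have ti i : leb.-integrable Omega (EFin \o pderive i (fun y => phi y ord0 i)).
  exact: (test_integrable mO (test_pderive i (tphi i))).
split; first exact: (tr_in_L2 (jacobian_in_L2 tphi)).
rewrite trE; split.
  have -> : EFin \o (fun x => \sum_i pderive i (fun y => phi y ord0 i) x) =
      (fun x => \sum_i (pderive i (fun y => phi y ord0 i) x)%:E)%E.
    by apply/funext => x; rewrite /= sumEFin.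
  by apply: integrable_sum => // i _; exact: ti.
rewrite (Rintegral_sum _ mO ti) big1// => i _.
exact: (Rintegral_pderive_test i (tphi i)).
Qed.

Lemma le0_small (x C : R) : 0 <= C -> (forall e, 0 < e -> x <= C * e) -> x <= 0.
Proof.
move=> C0 xC; rewrite leNgt; apply/negP => x0.
have e0 : 0 < x / (2 * (C + 1)) by rewrite divr_gt0// mulr_gt0// ltr_wpDl.
have := xC _ e0; rewrite leNgt => /negP; apply.
by rewrite mulrA ltr_pdivrMr ?mulr_gt0// ?ltr_wpDl//; nra.
Qed.

(** Expresses the integral of [f] against a divergence as an inner product of
    matrix fields, where convergence of Jacobians in L2 applies directly. *)
Lemma inner_scalar_mx (f : E -> R) (A : E -> 'M[R]_d) :
  inner Omega (fun x => (f x)%:M) A = \int[leb]_(x in Omega) (\tr (A x) * f x).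
Proof.
apply: eq_Rintegral => x _; rewrite /mxtrace mulr_suml; apply: eq_bigr => i _.
rewrite (bigD1 i)//= big1 ?addr0; first by rewrite mxE eqxx mulrC.
by move=> j ji; rewrite mxE eq_sym (negbTE ji) mul0r.
Qed.

Lemma scalar_mx_in_L2 n (f : E -> R) : in_L2 Omega f ->
  in_Lp Omega 2%:E (fun x => (f x)%:M : 'M[R]_n).
Proof.
move=> f2 i j; have -> : (fun x => ((f x)%:M : 'M[R]_n) i j) =
    (fun x => (i == j)%:R * f x + 0).
  by apply/funext => x; rewrite mxE addr0; case: (i == j); rewrite ?mul1r ?mul0r.
exact: (in_L2_lin _ f2 (in_L2_0 _)).
Qed.

(** The divergences of test fields approximating [v] are admissible in the
    constraint that defines [V], as they have mean zero; they converge to the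
    divergence of [v] in L2.  This holds whether or not Omega has finite
    measure. *)
Lemma V_div_sqr0 v : V Omega v ->
  \int[leb]_(x in Omega) (\tr (v.2 x) * \tr (v.2 x)) = 0.
Proof.
move=> [Xv dv]; have [[_ v2 _] _] := Xv.
pose D : E -> 'M[R]_d := fun x => (\tr (v.2 x))%:M.
have D2 : in_Lp Omega 2%:E D := scalar_mx_in_L2 (tr_in_L2 v2).
apply/eqP; rewrite eq_le Rintegral_ge0 ?andbT; last first.
  by move=> x _; rewrite -expr2 sqr_ge0.
rewrite -inner_scalar_mx; apply: (le0_small (normL2_ge0 Omega D)) => e e0.
have [phi [tphi _ vphi]] := X_approx Xv e0.
have J2 := jacobian_in_L2 tphi; have Z2 := in_Lp2_sub v2 J2.
have -> : inner Omega D v.2 =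
    1 * inner Omega D (v.2 - jacobian_of phi) + inner Omega D (jacobian_of phi).
  by rewrite -inner_linr// scale1r subrK.
have -> : inner Omega D (jacobian_of phi) = 0.
  rewrite innerC -(dv _ (div_test_Q tphi)) /D.
  rewrite innerC inner_scalar_mx; apply: eq_Rintegral => x _; exact: mulrC.
rewrite addr0 mul1r (le_trans (cauchy_schwarz mO D2 Z2))//.
by rewrite ler_wpM2l ?normL2_ge0// ltW.
Qed.

Lemma V_div_mul0 v (g : E -> R) : V Omega v -> in_L2 Omega g ->
  \int[leb]_(x in Omega) (\tr (v.2 x) * g x) = 0.
Proof.
move=> Vv g2; have [[[_ v2 _] _] _] := Vv.
have T2 := scalar_mx_in_L2 (n := 1) (tr_in_L2 v2).
have in11 (f h : E -> R) :
    inner Omega (fun x => (f x)%:M : 'M[R]_1) (fun x => (h x)%:M : 'M[R]_1) =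
    \int[leb]_(x in Omega) (f x * h x).
  by apply: eq_Rintegral => x _; rewrite !big_ord1 !mxE eqxx.
have T0 : normL2 Omega (fun x => (\tr (v.2 x))%:M : 'M[R]_1) = 0.
  by rewrite /normL2 in11 V_div_sqr0// sqrtr0.
have le0 h : in_L2 Omega h -> \int[leb]_(x in Omega) (\tr (v.2 x) * h x) <= 0.
  move=> h2; rewrite -in11.
  by rewrite (le_trans (cauchy_schwarz mO T2 (scalar_mx_in_L2 h2)))// T0 mul0r.
apply/eqP; rewrite eq_le le0//= -oppr_le0.
have := le0 _ (in_L2_lin (-1) g2 (in_L2_0 Omega)); congr (_ <= _).
under eq_Rintegral do rewrite addr0 mulrCA.
by rewrite RintegralZl ?mulN1r//; exact: in_L2_mul_integrable (tr_in_L2 v2) g2.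
Qed.

(** By the definition of weak derivatives the sum is the integral of
    [- div w * psi]; here [psi] need not have mean zero. *)
Lemma V_orthogonal_gradient w psi : V Omega w -> test_function Omega psi ->
  \sum_j \int[leb]_(x in Omega) (w.1 x ord0 j * pderive j psi x) = 0.
Proof.
move=> Vw tpsi; have [[[_ w2 ww] _] _] := Vw.
under eq_bigr do rewrite ww//.
rewrite sumrN -Rintegral_sum//; last first.
  by move=> j; exact: in_L2_mul_integrable (w2 j j) (test_in_L2 tpsi).
under eq_Rintegral do rewrite -mulr_suml.
by rewrite V_div_mul0 ?oppr0//; exact: test_in_L2.
Qed.

(** [phi_i d_j phi_i] is half of [d_j (phi_i^2)], so the convection form reduces
    to integrals of [w] against the gradients of the test functions
    [phi_i^2]. *)
Lemma b_test0 w (phi : E -> E) : V Omega w -> test_field Omega phi ->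
  b Omega w (phi, jacobian_of phi) (phi, jacobian_of phi) = 0.
Proof.
move=> Vw tphi; have [[[w1 _ _] _] _] := Vw.
pose phi2 i x := phi x ord0 i * phi x ord0 i.
have t2 i : test_function Omega (phi2 i) := test_mul (tphi i) (tphi i).
have iw i j : leb.-integrable Omega
    (EFin \o (fun x => w.1 x ord0 j * pderive j (phi2 i) x)).
  exact: in_L2_mul_integrable (w1 ord0 j) (test_in_L2 (test_pderive j (t2 i))).
transitivity (\int[leb]_(x in Omega) (2^-1 *
    \sum_i \sum_j w.1 x ord0 j * pderive j (phi2 i) x)).
  apply: eq_Rintegral => x _; rewrite mulr_sumr; apply: eq_bigr => i _.
  rewrite mulr_sumr; apply: eq_bigr => j _ /=; rewrite jacobian_ofE /phi2.
  rewrite pderive_mul; [|exact: smooth_differentiable (tphi i).1..].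
  by field.
have isum i : leb.-integrable Omega
    (EFin \o (fun x => \sum_j w.1 x ord0 j * pderive j (phi2 i) x)).
  have -> : EFin \o (fun x => \sum_j w.1 x ord0 j * pderive j (phi2 i) x) =
      (fun x => \sum_j (w.1 x ord0 j * pderive j (phi2 i) x)%:E)%E.
    by apply/funext => x; rewrite /= sumEFin.
  by apply: integrable_sum => // j _; exact: iw.
rewrite RintegralZl//; last first.
  have -> : EFin \o (fun x => \sum_i \sum_j w.1 x ord0 j * pderive j (phi2 i) x) =
      (fun x => \sum_i (\sum_j w.1 x ord0 j * pderive j (phi2 i) x)%:E)%E.
    by apply/funext => x; rewrite /= sumEFin.
  by apply: integrable_sum => // i _; exact: isum.
rewrite Rintegral_sum// big1 ?mulr0// => i _.
by rewrite Rintegral_sum// V_orthogonal_gradient.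
Qed.

Variable M : R.
Hypothesis hM : convection_constant Omega M.

Let conv_int u w v : X Omega u -> X Omega w -> X Omega v ->
  leb.-integrable Omega (EFin \o convection u w v).
Proof. by move=> Xu Xw Xv; case: (hM Xu Xw Xv). Qed.

Let Rintegral_lin a (f g h : E -> R) :
  leb.-integrable Omega (EFin \o f) -> leb.-integrable Omega (EFin \o g) ->
  (forall x, h x = a * f x + g x) ->
  \int[leb]_(x in Omega) h x =
  a * \int[leb]_(x in Omega) f x + \int[leb]_(x in Omega) g x.
Proof.
move=> fi gi hE; rewrite -RintegralZl// -RintegralD//.
  by apply: eq_Rintegral => x _; exact: hE.
exact: (integrableZl mO a fi).
Qed.

Lemma b_lin1 a u u' w v : X Omega u -> X Omega u' -> X Omega w -> X Omega v ->
  b Omega (a *: u + u') w v = a * b Omega u w v + b Omega u' w v.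
Proof.
move=> Xu Xu' Xw Xv; apply: Rintegral_lin; [exact: conv_int..|move=> x].
rewrite mulr_sumr -big_split; apply: eq_bigr => i _ /=.
rewrite mulr_sumr -big_split; apply: eq_bigr => j _ /=.
rewrite -[(a *: u.1 + u'.1) x]/(a *: u.1 x + u'.1 x) !mxE; ring.
Qed.

Lemma b_lin2 a u w w' v : X Omega u -> X Omega w -> X Omega w' -> X Omega v ->
  b Omega u (a *: w + w') v = a * b Omega u w v + b Omega u w' v.
Proof.
move=> Xu Xw Xw' Xv; apply: Rintegral_lin; [exact: conv_int..|move=> x].
rewrite mulr_sumr -big_split; apply: eq_bigr => i _ /=.
rewrite mulr_sumr -big_split; apply: eq_bigr => j _ /=.
rewrite -[(a *: w.2 + w'.2) x]/(a *: w.2 x + w'.2 x) !mxE; ring.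
Qed.

Lemma b_lin3 a u w v v' : X Omega u -> X Omega w -> X Omega v -> X Omega v' ->
  b Omega u w (a *: v + v') = a * b Omega u w v + b Omega u w v'.
Proof.
move=> Xu Xw Xv Xv'; apply: Rintegral_lin; [exact: conv_int..|move=> x].
rewrite mulr_sumr -big_split; apply: eq_bigr => i _ /=.
rewrite mulr_sumr -big_split; apply: eq_bigr => j _ /=.
rewrite -[(a *: v.1 + v'.1) x]/(a *: v.1 x + v'.1 x) !mxE; ring.
Qed.

(** Approximating [v] by a test field [p], with [z = v - p], one has
    [b(w, v, v) = b(w, z, v) + b(w, p, z) + b(w, p, p)]; the last term vanishes
    and the others are small with the gradient of [z].  The convection bound is
    one-sided, hence only [b(w, v, v) <= 0] comes out; the opposite inequality
    is the same fact for [- w]. *)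
Lemma b_skew w v : V Omega w -> X Omega v -> b Omega w v v = 0.
Proof.
have le0 w' : V Omega w' -> X Omega v -> b Omega w' v v <= 0.
  move=> Vw Xv; have Xw := Vw.1; have [[_ v2 _] _] := Xv.
  pose C := `|M| * normL2 Omega w'.2 * (2 * normL2 Omega v.2 + 1).
  apply: (@le0_small _ C).
    by rewrite /C !mulr_ge0 ?addr_ge0 ?mulr_ge0 ?normL2_ge0.
  move=> e e0; pose e1 := Num.min e 1.
  have e10 : 0 < e1 by rewrite lt_min e0 ltr01.
  have [phi [tphi _ zlt]] := X_approx Xv e10.
  pose p : field := (phi, jacobian_of phi).
  have Xp : X Omega p := test_field_X mO tphi.
  pose z : field := -1 *: p + v.
  have Xz : X Omega z := X_lin mO (-1) Xp Xv.
  have vE : v = 1 *: z + p by rewrite /z scale1r scaleN1r addrAC addNr add0r.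
  have z2E : z.2 = v.2 - jacobian_of phi by rewrite /z /= scaleN1r addrC.
  have zlt' : normL2 Omega z.2 < e1 by rewrite z2E.
  have J2 := jacobian_in_L2 tphi.
  have ple : normL2 Omega p.2 <= normL2 Omega v.2 + e1.
    have := ler_normL2D mO v2 (in_Lp2_sub J2 v2).
    rewrite -(normL2N _ (_ - _)) opprB -z2E (addrC v.2) subrK => h.
    by rewrite (le_trans h)// lerD2l ltW.
  rewrite {1}vE b_lin2// mul1r [X in _ + b _ _ _ X]vE b_lin3// (b_test0 Vw tphi).
  have [_ _ b1] := hM Xw Xz Xv; have [_ _ b2] := hM Xw Xp Xz.
  have e1e : e1 <= e by rewrite ge_min lexx.
  have e11 : e1 <= 1 by rewrite ge_min lexx orbT.
  rewrite /C; move: b1 b2 zlt' ple (normL2_ge0 Omega w'.2) (normL2_ge0 Omega v.2)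
    (normL2_ge0 Omega z.2) (normL2_ge0 Omega p.2) (ler_norm M) (normr_ge0 M).
  move: (normL2 Omega w'.2) (normL2 Omega v.2) (normL2 Omega z.2) (normL2 Omega p.2)
    (b _ _ _ _) (b _ _ _ _) `|M| => a y s t b2 b1 M' h1 h2 s1 pt a0 y0 s0 t0 MM' M'0.
  have k1 : b1 <= M' * a * e * y.
    rewrite (le_trans h1)//.
    rewrite (@le_trans _ _ (M' * a * s * y))// ?ler_wpM2r//.
    by rewrite ler_wpM2l ?mulr_ge0// (le_trans (ltW s1)).
  have k2 : b2 <= M' * a * (y + 1) * e.
    rewrite (le_trans h2)//.
    rewrite (@le_trans _ _ (M' * a * t * s))// ?ler_wpM2r//.
    rewrite ler_pM ?mulr_ge0// ?(le_trans (ltW s1))//.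
    by rewrite ler_wpM2l ?mulr_ge0// (le_trans pt)// lerD2l.
  nra.
move=> Vw Xv; apply/eqP; rewrite eq_le le0//= -oppr_le0.
(* [-2 *: w + w] is [- w], written as a combination of members of [V]. *)
have := le0 _ (V_lin mO (-2) Vw Vw) Xv; congr (_ <= _).
by rewrite b_lin1//; [ring|exact: Vw.1..].
Qed.

End solenoidal.

(** * Real estimates behind the contraction *)
Section real_estimates.
Context (R : realType).

(** Here [s], [g] stand for the norms of the old error and of its gradient, [s']
    and [g'] for those of the new one, [i'] for the norm of its interpolant, [h]
    for its interpolation error, [E] for the noise, [p] for
    [s^(1/2) g^(1/2)], [A] for [alpha^2], and [c] for [C_I H]. *)
Lemma energy_step (nu mu K A r c s g s' g' i' h E p : R) :
  0 < nu -> 0 < mu -> 0 < r ->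
  0 <= A -> K ^+ 2 <= nu ^+ 2 * A -> 4 * nu * A ^+ 2 <= mu * r ^+ 2 ->
  mu * c ^+ 2 <= nu ->
  0 <= s -> 0 <= g -> 0 <= s' -> 0 <= h -> p ^+ 2 = s * g ->
  nu * g' ^+ 2 + mu * i' ^+ 2 <= K * p * g' + mu * (E * i') ->
  s' <= i' + h -> h <= c * g' ->
  nu / 2 * g' ^+ 2 + mu / 4 * s' ^+ 2 <=
    3 / 4 * r * (nu / 2 * g ^+ 2 + mu / 4 * s ^+ 2) + mu * E ^+ 2.
Proof.
move=> nu0 mu0 r0 A0 KA hA hc s0 g0 s'0 h0 psg energy s'le hle.
(* Young's inequality on both terms of the right-hand side. *)
have step1 : nu * g' ^+ 2 + mu * i' ^+ 2 <= nu * A * (s * g) + mu * E ^+ 2.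
  have young1 : K * p * g' <= nu / 2 * g' ^+ 2 + nu * A * (s * g) / 2.
    have h1 : (K * p) ^+ 2 <= nu ^+ 2 * A * (s * g).
      by rewrite exprMn psg ler_wpM2r// mulr_ge0.
    rewrite -(ler_pM2l nu0); have := sqr_ge0 (nu * g' - K * p); nra.
  have young2 : mu * (E * i') <= mu / 2 * i' ^+ 2 + mu / 2 * E ^+ 2.
    have : 0 <= mu * (E - i') ^+ 2 by rewrite mulr_ge0 ?sqr_ge0// ltW.
    nra.
  nra.
(* The interpolant and half of the viscous term control the L2 norm. *)
have step2 : mu / 4 * s' ^+ 2 <= mu / 2 * i' ^+ 2 + nu / 2 * g' ^+ 2.
  have h1 : h ^+ 2 <= c ^+ 2 * g' ^+ 2.
    by rewrite -exprMn ler_pXn2r// ?nnegrE// (le_trans h0).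
  have h2 : s' ^+ 2 <= 2 * i' ^+ 2 + 2 * h ^+ 2.
    rewrite (@le_trans _ _ ((i' + h) ^+ 2))//.
      by rewrite ler_pXn2r// ?nnegrE// (le_trans s'0).
    by have := sqr_ge0 (i' - h); nra.
  have h3 : mu * h ^+ 2 <= nu * g' ^+ 2.
    rewrite (@le_trans _ _ (mu * (c ^+ 2 * g' ^+ 2)))//.
      by rewrite ler_wpM2l// ltW.
    by rewrite mulrA ler_wpM2r// sqr_ge0.
  have : mu * s' ^+ 2 <= mu * (2 * i' ^+ 2 + 2 * h ^+ 2) by rewrite ler_wpM2l// ltW.
  nra.
(* Dividing by [r], this is [t g <= 3/8 g^2 + 3/4 t^2] with [t = A s / r]; the
   discriminant condition [1 <= 4 * 3/8 * 3/4] holds with room to spare, so a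
   factor smaller than 3/4, though not below 1/sqrt 2, would do as well. *)
have step3 : nu * A * (s * g) <= 3 / 4 * r * (nu / 2 * g ^+ 2 + mu / 4 * s ^+ 2).
  pose t := A * s / r.
  have As : A * s = r * t by rewrite /t; field; rewrite gt_eqF.
  have h1 : 4 * nu * t ^+ 2 <= mu * s ^+ 2.
    rewrite /t (_ : 4 * nu * _ = 4 * nu * A ^+ 2 * (s ^+ 2 / r ^+ 2));
      last by field; rewrite gt_eqF.
    rewrite mulrA ler_pdivrMr ?exprn_gt0//.
    rewrite (_ : mu * _ * _ = mu * r ^+ 2 * s ^+ 2); last by ring.
    by rewrite ler_wpM2r// sqr_ge0.
  rewrite (_ : nu * A * _ = r * (nu * t * g));
    last by rewrite -mulrA (mulrA A) As; ring.
  have -> : 3 / 4 * r * (nu / 2 * g ^+ 2 + mu / 4 * s ^+ 2) =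
      r * (3 / 4 * (nu / 2 * g ^+ 2 + mu / 4 * s ^+ 2)) by ring.
  apply: ler_wpM2l; first exact: ltW.
  have : 0 <= nu * (3 / 8 * (g - 4 / 3 * t) ^+ 2).
    by apply: mulr_ge0; [exact: ltW|have := sqr_ge0 (g - 4 / 3 * t); lra].
  have : 0 <= nu * t ^+ 2 by rewrite mulr_ge0 ?sqr_ge0// ltW.
  by move=> p1 p2; clear -h1 p1 p2; lra.
have : 0 <= mu * i' ^+ 2 by rewrite mulr_ge0 ?sqr_ge0// ltW.
nra.
Qed.

(** The recursion drives [y] towards [B / (1 - q)], and the gap up to
    [B / (1 - r)] makes the bound hold exactly after finitely many steps. *)
Lemma contraction_near (y : nat -> R) (q r B : R) :
  0 <= q -> q < r -> r < 1 -> 0 < B ->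
  (forall k, y k.+1 <= q * y k + B) ->
  \forall k \near \oo, y k <= B / (1 - r).
Proof.
move=> q0 qr r1 B0 yS.
have q1 : q < 1 by exact: lt_trans r1.
have y_le k : y k <= q ^+ k * `|y 0| + B / (1 - q).
  elim: k => [|k IH].
    rewrite expr0 mul1r (le_trans (ler_norm _))// lerDl divr_ge0 ?ltW// subr_gt0//.
  rewrite (le_trans (yS k))// exprS -mulrA.
  have := ler_wpM2l q0 IH; rewrite mulrDr => h.
  have -> : B / (1 - q) = q * (B / (1 - q)) + B.
    by field; rewrite gt_eqF// subr_gt0.
  lra.
pose eta := B / (1 - r) - B / (1 - q).
have eta0 : 0 < eta.
  by rewrite subr_gt0 ltr_pM2l// ltf_pV2 ?posrE ?subr_gt0//; lra.
have : `|y 0| * q ^+ k @[k --> \oo] --> (0 : R).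
  rewrite -[X in _ --> X](mulr0 `|y 0|); apply: cvgM; first exact: cvg_cst.
  by apply: cvg_expr; rewrite ger0_norm.
move=> /cvgrPdist_le /(_ _ eta0); apply: filterS => k.
rewrite sub0r normrN ger0_norm; last by rewrite mulr_ge0// exprn_ge0.
by move=> h; rewrite (le_trans (y_le k))// mulrC -lerBrDr.
Qed.

End real_estimates.

(** * The error of the nudged Picard iteration *)
Section data_assimilation.
Context (R : realType) (d : nat) (Omega : set 'rV[R]_d).
Hypothesis mO : measurable Omega.
Notation E := 'rV[R]_d.
Notation leb := (lebesgue_rV R d).
Notation field := (sobolev_field R d).
Implicit Types u v w : field.

Lemma Hm1_le (f : (E -> E) -> R) v : Hm1 Omega f -> X Omega v ->
  f v.1 <= normHm1 Omega f * normL2 Omega v.2.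
Proof.
move=> [fl [C fC]] Xv; have [[_ v2 _] _] := Xv.
have [n0|n0] := eqVneq (normL2 Omega v.2) 0.
  by rewrite n0 mulr0 (le_trans (ler_norm _))// (le_trans (fC v Xv))// n0 mulr0.
have n_gt0 : 0 < normL2 Omega v.2 by rewrite lt_def n0 normL2_ge0.
(* [w] is [a *: v], in the form in which the linearity of [f] is given. *)
pose a := (normL2 Omega v.2)^-1; pose w : field := (a - 1) *: v + v.
have Xw : X Omega w := X_lin mO _ Xv Xv.
have fw : f w.1 = a * f v.1 by rewrite fl//; ring.
have w1 : normL2 Omega w.2 = 1.
  rewrite /w /= scalerBl scale1r subrK normL2Z// ger0_norm ?invr_ge0 ?ltW//.
  exact: mulVf.
rewrite (le_trans (ler_norm _))// -ler_pdivrMr//.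
have -> : `|f v.1| / normL2 Omega v.2 = `|f w.1|.
  by rewrite fw normrM ger0_norm ?invr_ge0 1?ltW// mulrC.
apply: ub_le_sup; last by exists w => //; split=> //; rewrite w1.
exists `|C| => _ [z [Xz z1] <-]; rewrite (le_trans (fC z Xz))//.
rewrite (le_trans (ler_wpM2r (normL2_ge0 _ _) (ler_norm C)))//.
by rewrite ler_piMr.
Qed.

Variables (M nu alpha : R) (f : (E -> E) -> R) (u : field).
Hypotheses (hM : convection_constant Omega M) (nu_gt0 : 0 < nu) (hf : Hm1 Omega f)
  (alphaE : alpha = M * nu ^- 2 * normHm1 Omega f) (hu : steady_NSE Omega nu f u).

(** Testing the steady equation with [u] gives [nu |Du|^2 = <f, u>], the
    convection term being zero, so [M |Du| <= nu alpha].  The constant is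
    [M |Du|], cut off at zero because no sign is imposed on [M]. *)
Lemma steady_convection_bound : exists K : R, [/\ K ^+ 2 <= nu ^+ 2 * alpha ^+ 2 &
  forall v w, X Omega v -> X Omega w ->
    b Omega v u w <=
      K * (Num.sqrt (normL2 Omega v.1) * Num.sqrt (normL2 Omega v.2)) *
      normL2 Omega w.2].
Proof.
have [Vu hNSE] := hu; have Xu := Vu.1; have [[_ u2 _] _] := Xu.
exists (Num.max (M * normL2 Omega u.2) 0); split; last first.
  move=> v w Xv Xw; have [_ h _] := hM Xv Xu Xw; rewrite (le_trans h)//.
  rewrite ler_wpM2r ?normL2_ge0//.
  rewrite [leLHS](_ : _ = M * normL2 Omega u.2 *
      (Num.sqrt (normL2 Omega v.1) * Num.sqrt (normL2 Omega v.2))); last by ring.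
  by rewrite ler_wpM2r ?mulr_ge0 ?sqrtr_ge0// le_max lexx.
have [K0|K0] := leP (M * normL2 Omega u.2) 0.
  by rewrite expr0n mulr_ge0 ?sqr_ge0.
have n0 : 0 < normL2 Omega u.2.
  rewrite lt_def normL2_ge0 andbT; apply/eqP => n0.
  by move: K0; rewrite n0 mulr0 ltxx.
have M0 : 0 < M by move: K0; rewrite pmulr_lgt0.
have := hNSE u Vu; rewrite (b_skew mO hM Vu Xu) addr0 -sqr_normL2 => fu.
have := Hm1_le hf Xu; rewrite -fu expr2 mulrA ler_pM2r// => nuN.
have Kle : M * normL2 Omega u.2 <= nu * alpha.
  have -> : nu * alpha = M * (normHm1 Omega f / nu).
    by rewrite alphaE; field; rewrite gt_eqF.
  by rewrite ler_pM2l// ler_pdivlMr// mulrC.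
by rewrite -exprMn ler_pXn2r// ?nnegrE ?(le_trans _ Kle) ?ltW.
Qed.

Variables (H C_I : R) (I_H : (E -> E) -> (E -> E)).
Hypothesis hI : coarse_interpolation Omega H C_I I_H.

Let XB v w : X Omega v -> X Omega w -> X Omega (v - w).
Proof. by move=> Xv Xw; rewrite addrC -scaleN1r; exact: X_lin. Qed.

(** The difference of convections splits as
    [b(v, v', e) - b(u, u, e) = b(v, e, e) - b(u - v, u, e)], whose first term
    is zero by skew-symmetry.  Since [I_H] is linear only almost everywhere, the
    nudging term is rewritten under the integral. *)
Lemma error_energy mu eps v v' : X Omega eps -> V Omega v -> V Omega v' ->
  CDA_Picard_step Omega nu mu f I_H (u + eps) v v' ->
  nu * normL2 Omega (v' - u).2 ^+ 2 + mu * normL2 Omega (I_H (v' - u).1) ^+ 2 =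
  b Omega (u - v) u (v' - u) + mu * inner Omega (I_H eps.1) (I_H (v' - u).1).
Proof.
move=> Xeps Vv Vv' step; have [Vu hNSE] := hu.
have Xu := Vu.1; have Xv := Vv.1; have Xv' := Vv'.1.
have [I2 Ilin _ _] := hI.
pose e := v' - u; have eE : e = -1 *: u + v' by rewrite scaleN1r addrC.
have Ve : V Omega e by rewrite eE; exact: V_lin.
have Xe := Ve.1; have [[_ e2 _] _] := Xe.
have [[_ u2 _] _] := Xu.
have v'E : v' = 1 *: e + u by rewrite scale1r subrK.
have Xd : X Omega (u + eps) by rewrite -[u]scale1r; exact: X_lin.
have grad : inner Omega v'.2 e.2 = normL2 Omega e.2 ^+ 2 + inner Omega u.2 e.2.
  by rewrite {1}v'E inner_linl// mul1r sqr_normL2.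
have conv : b Omega v v' e = b Omega u u e - b Omega (u - v) u e.
  rewrite {1}v'E (b_lin2 mO hM)// (b_skew mO hM Vv Xe) mulr0 add0r.
  have -> : u - v = -1 *: v + u by rewrite scaleN1r addrC.
  by rewrite (b_lin1 mO hM)//; ring.
have nudge : inner Omega (I_H v'.1 - I_H (u + eps).1) (I_H e.1) =
    normL2 Omega (I_H e.1) ^+ 2 - inner Omega (I_H eps.1) (I_H e.1).
  have -> : normL2 Omega (I_H e.1) ^+ 2 - inner Omega (I_H eps.1) (I_H e.1) =
      inner Omega (I_H e.1 - I_H eps.1) (I_H e.1).
    rewrite sqr_normL2 addrC -mulN1r -inner_linl//; try exact: I2.
    by rewrite scaleN1r addrC.
  rewrite /inner /Rintegral; congr fine.
  apply: ae_eq_integral => //.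
  - apply: measurable_int; apply: (contract_integrable mO) (I2 _ Xe).
    exact: in_Lp2_sub (I2 _ Xv') (I2 _ Xd).
  - apply: measurable_int; apply: (contract_integrable mO) (I2 _ Xe).
    exact: in_Lp2_sub (I2 _ Xe) (I2 _ Xeps).
  have := Ilin 1 u eps Xu Xeps; have := Ilin (-1) u v' Xu Xv'.
  apply: filterS2 => x h1 h2 xO; congr EFin.
  apply: eq_bigr => i _; apply: eq_bigr => j _; congr (_ * _).
  have {}h1 := h1 xO; have {}h2 := h2 xO.
  rewrite -[LHS]/((I_H v'.1 x - I_H (u.1 + eps.1) x) i j).
  rewrite -[RHS]/((I_H e.1 x - I_H eps.1 x) i j).
  have -> : e.1 = -1 *: u.1 + v'.1 by rewrite eE.
  rewrite h1 -{1}[u.1]scale1r h2 !mxE; ring.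
have := step e Ve; have := hNSE e Ve; rewrite nudge grad conv.
lra.
Qed.

Lemma error_contraction mu r eps v v' : 0 < mu -> 0 < r -> 0 < H -> 0 < C_I ->
  4 * nu * alpha ^+ 4 / r ^+ 2 <= mu -> mu <= nu / (C_I ^+ 2 * H ^+ 2) ->
  X Omega eps -> V Omega v -> V Omega v' ->
  CDA_Picard_step Omega nu mu f I_H (u + eps) v v' ->
  nu / 2 * normL2 Omega (v' - u).2 ^+ 2 +
    mu / 4 * normL2 Omega (v' - u).1 ^+ 2 <=
  3 / 4 * r * (nu / 2 * normL2 Omega (v - u).2 ^+ 2 +
               mu / 4 * normL2 Omega (v - u).1 ^+ 2) +
  mu * normL2 Omega (I_H eps.1) ^+ 2.
Proof.
move=> mu0 r0 H0 CI0 mu_lo mu_hi Xeps Vv Vv' step.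
have Xu := hu.1.1; have Xv := Vv.1; have Xv' := Vv'.1.
have Xe' := XB Xv' Xu; have Xz := XB Xu Xv.
have [[e'2 _ _] _] := Xe'.
have [I2 _ Iapprox _] := hI.
have [K [KA Kb]] := steady_convection_bound.
have zE1 : normL2 Omega (u - v).1 = normL2 Omega (v - u).1.
  by rewrite -normL2N; congr normL2; rewrite -[RHS]opprK; congr (- _); exact/esym/opprB.
have zE2 : normL2 Omega (u - v).2 = normL2 Omega (v - u).2.
  by rewrite -normL2N; congr normL2; rewrite -[RHS]opprK; congr (- _); exact/esym/opprB.
have triangle : normL2 Omega (v' - u).1 <=
    normL2 Omega (I_H (v' - u).1) + normL2 Omega (I_H (v' - u).1 - (v' - u).1).
  rewrite -(normL2N _ (I_H _ - _)) opprB.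
  have {1}-> : (v' - u).1 = I_H (v' - u).1 + ((v' - u).1 - I_H (v' - u).1).
    by rewrite [RHS]addrC subrK.
  exact: (ler_normL2D mO (I2 _ Xe') (in_Lp2_sub e'2 (I2 _ Xe'))).
have nudge_le : mu * inner Omega (I_H eps.1) (I_H (v' - u).1) <=
    mu * (normL2 Omega (I_H eps.1) * normL2 Omega (I_H (v' - u).1)).
  apply: ler_wpM2l; first exact: ltW.
  exact: (cauchy_schwarz mO (I2 _ Xeps) (I2 _ Xe')).
have conv_le := Kb _ _ Xz Xe'; rewrite zE1 zE2 in conv_le.
pose p := Num.sqrt (normL2 Omega (v - u).1) * Num.sqrt (normL2 Omega (v - u).2).
have hA : 4 * nu * (alpha ^+ 2) ^+ 2 <= mu * r ^+ 2.
  by rewrite -exprM -ler_pdivrMr ?exprn_gt0.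
have hc : mu * (C_I * H) ^+ 2 <= nu.
  move: mu_hi; rewrite -exprMn ler_pdivlMr//.
  exact: exprn_gt0 (mulr_gt0 CI0 H0).
have p2 : p ^+ 2 = normL2 Omega (v - u).1 * normL2 Omega (v - u).2.
  by rewrite /p exprMn !sqr_sqrtr ?normL2_ge0.
have energy := lerD conv_le nudge_le.
rewrite -(error_energy Xeps Vv Vv' step) in energy.
exact: (energy_step nu_gt0 mu0 r0 (sqr_ge0 alpha) KA hA hc
  (normL2_ge0 _ _) (normL2_ge0 _ _) (normL2_ge0 _ _) (normL2_ge0 _ _) p2
  energy triangle (Iapprox _ Xe')).
Qed.

End data_assimilation.

Theorem theorem4p6 (R : realType) (d : nat) (hd : d = 2%N \/ d = 3%N)
  (Omega : set 'rV[R]_d) (Omega_open : open Omega)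
  (Omega_connected : connected Omega)
  (Omega_geom : convex_polytope Omega \/ smooth_boundary Omega)
  (M : R) (hM : convection_constant Omega M)
  (nu : R) (nu_gt0 : 0 < nu)
  (f : ('rV[R]_d -> 'rV[R]_d) -> R) (hf : Hm1 Omega f)
  (alpha : R) (alphaE : alpha = M * nu ^- 2 * normHm1 Omega f)
  (u : sobolev_field R d) (hu : steady_NSE Omega nu f u)
  (hu_Linf : in_Lp Omega +oo%E u.2)
  (H C_I : R) (H_gt0 : 0 < H) (C_I_gt0 : 0 < C_I)
  (I_H : ('rV[R]_d -> 'rV[R]_d) -> ('rV[R]_d -> 'rV[R]_d))
  (hI_H : coarse_interpolation Omega H C_I I_H)
  (eps : sobolev_field R d) (eps_V : V Omega eps)
  (eps_neq0 : normL2 Omega (I_H eps.1) != 0)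
  (delta : R) (delta_ge0 : 0 <= delta)
  (hdelta : normL2 Omega (u + eps).2 <= (1 + delta) * normL2 Omega u.2)
  (mu : R) (mu_gt0 : 0 < mu)
  (uk : nat -> sobolev_field R d) (uk_V : forall k, V Omega (uk k))
  (hPicard : forall k,
     CDA_Picard_step Omega nu mu f I_H (u + eps) (uk k) (uk k.+1))
  (r : R) (r_gt0 : 0 < r) (r_lt1 : r < 1)
  (mu_lower : 4 * nu * alpha ^+ 4 / r ^+ 2 <= mu)
  (mu_upper : mu <= nu / (C_I ^+ 2 * H ^+ 2))
  (H_upper : alpha != 0 -> H <= r / (2 * C_I * alpha ^+ 2)) :
  \forall k \near \oo,
    normL2 Omega (uk k - u).1
      <= Num.sqrt (4 / (1 - r)) * normL2 Omega (I_H eps.1).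
Proof.
have mO := open_measurable_rV Omega_open.
pose N := normL2 Omega (I_H eps.1).
have N_gt0 : 0 < N by rewrite lt_def eps_neq0 normL2_ge0.
pose y k := nu / 2 * normL2 Omega (uk k - u).2 ^+ 2 +
            mu / 4 * normL2 Omega (uk k - u).1 ^+ 2.
have yS k : y k.+1 <= 3 / 4 * r * y k + mu * N ^+ 2.
  exact: (error_contraction mO hM nu_gt0 hf alphaE hu hI_H mu_gt0 r_gt0 H_gt0
    C_I_gt0 mu_lower mu_upper eps_V.1 (uk_V k) (uk_V k.+1) (hPicard k)).
have q0 : 0 <= 3 / 4 * r by lra.
have qr : 3 / 4 * r < r by lra.
have B0 : 0 < mu * N ^+ 2 by rewrite mulr_gt0// exprn_gt0.
apply: filterS (contraction_near q0 qr r_lt1 B0 yS) => k yk.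
have r1 : 0 < 1 - r by rewrite subr_gt0.
rewrite -(@ler_pXn2r _ 2)// ?nnegrE ?mulr_ge0 ?sqrtr_ge0 ?normL2_ge0//.
have c0 : 0 <= 4 / (1 - r) by rewrite divr_ge0// ltW.
rewrite exprMn (sqr_sqrtr c0) -(ler_pM2l mu_gt0).
have : 0 <= nu / 2 * normL2 Omega (uk k - u).2 ^+ 2.
  by apply: mulr_ge0; [lra|exact: sqr_ge0].
have -> : mu * (4 / (1 - r) * normL2 Omega (I_H eps.1) ^+ 2) =
    4 * (mu * N ^+ 2 / (1 - r)) by rewrite /N; ring.
by move: yk; rewrite /y; lra.
Qed.
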